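(* Let $B\in\mathbb{C}^{n\times n}$ be a matrix whose Hermitian part $B_H$ is positive semi-definite (i.e. the ODE system $\mathbf{x}'(t)=-B\mathbf{x}(t)$ is conservative-dissipative). (a) The matrix $B$ is hypocoercive (with hypocoercivity index $m_{HC}\in\mathbb{N}_0$) if and only if $$\|e^{-Bt}\|_2 = 1-c\,t^a+\mathcal{O}(t^{a+1})\qquad\text{for } t\in[0,\epsilon),$$ for some $a,c,\epsilon>0$. In this case, necessarily $a=2m_{HC}+1$. (b) Moreover, for $m_{HC}\ge 1$, the optimal multiplicative factor $c$ in the expansion in (a) is given by $$c=\frac{1}{(2m_{HC}+1)!\,\binom{2m_{HC}}{m_{HC}}}\ \min_{\mathbf{x}\in\ker(\widetilde{\widetilde T}_{m_{HC}-1}),\ \|\mathbf{x}\|_2=1}\langle \mathbf{x},(B^* )^{m_{HC}}B_H B^{m_{HC}}\mathbf{x}\rangle$$ $$\phantom{c}=\frac{1}{(2m_{HC}+1)!\,\binom{2m_{HC}}{m_{HC}}}\ \min_{\mathbf{x}\in\ker(\widetilde{\widetilde T}_{m_{HC}-1}),\ \|\mathbf{x}\|_2=1}\langle \mathbf{x},(B_A^* )^{m_{HC}}B_H B_A^{m_{HC}}\mathbf{x}\rangle,$$ and for $m_{HC}=0$ one has $c=\min_{\|\mathbf{x}\|_2=1}\langle\mathbf{x},B_H\mathbf{x}\rangle$.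
   Context: $B^*$ is the conjugate transpose of $B\in\mathbb{C}^{n\times n}$, $B_H:=(B+B^* )/2$ is its Hermitian part and $B_A:=(B-B^* )/2$ its anti-Hermitian part. $\langle\cdot,\cdot\rangle$ is the standard inner product on $\mathbb{C}^n$; $\|\cdot\|_2$ denotes the Euclidean norm of vectors and the spectral (operator) norm of matrices. $\mathbb{N}_0=\{0,1,2,\dots\}$. A matrix $B$ is called positive conservative-dissipative if $B_H$ is positive semi-definite; equivalently, the ODE system $\mathbf{x}'(t)=-B\mathbf{x}(t)$ is called conservative-dissipative. $B$ is called hypocoercive if all eigenvalues of $B$ have strictly positive real part. For a positive conservative-dissipative $B$, the hypocoercivity index $m_{HC}$ is the smallest $m\in\mathbb{N}_0$ (if it exists) such that $T_m:=\sum_{j=0}^m B_A^j B_H (B_A^* )^j$ is positive definite; if no such $m$ exists, $m_{HC}=\infty$. It is known that $B$ is hypocoercive if and only if $m_{HC}$ is finite. For $m\in\mathbb{N}_0$, $\widetilde{\widetilde T}_m:=\sum_{j=0}^m (B^* )^jB_HB^j$. The notation $\mathcal{O}(t^{a+1})$ on $[0,\epsilon)$ stands for a term bounded in absolute value by $M t^{a+1}$ on $[0,\epsilon)$ for some constant $M>0$. *)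

(* Defs.v *)
From HB Require Import structures.
From mathcomp Require Import all_boot all_order all_algebra.
From mathcomp Require Import complex.
From mathcomp Require Import all_classical all_reals all_analysis.

Set Implicit Arguments.
Unset Strict Implicit.
Unset Printing Implicit Defensive.

Import Order.TTheory GRing.Theory Num.Theory.
Import numFieldNormedType.Exports.

Local Open Scope classical_set_scope.
Local Open Scope ring_scope.
Local Open Scope sesquilinear_scope.
Local Open Scope complex_scope.

(* The limit is taken for the (entrywise) topology of 'M[K]_n. *)
Definition expmx (K : numFieldType) (n : nat) (A : 'M[K]_n) : 'M[K]_n :=
  limn (series (fun k : nat => (k`!%:R)^-1 *: A ^+ k)).

Section ComplexMatrices.
Variables (R : realType) (n : nat).
Implicit Types (A B : 'M[R[i]]_n) (x y : 'cV[R[i]]_n) (m : nat).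

(* dotmx is the standard inner product of row vectors, linear on the left:
   innerp x y = \sum_i x_i * (y_i)^*. *)
Definition innerp x y : R[i] := dotmx x^T y^T.

Definition norm2 x : R := Num.sqrt (complex.Re (innerp x x)).

Definition opnorm2 A : R :=
  sup [set norm2 (A *m x) | x in [set x | norm2 x = 1]].

(* The order of R[i] is partial: 0 <= z (resp. 0 < z) means that z is real and
   nonnegative (resp. positive). *)
Definition psdmx A : Prop :=
  A \is hermsymmx /\ forall x, 0 <= innerp x (A *m x).

Definition posdefmx A : Prop :=
  A \is hermsymmx /\ forall x, x != 0 -> 0 < innerp x (A *m x).

Definition hermpart B : 'M[R[i]]_n := 2%:R^-1 *: (B + B^t*).

Definition antihermpart B : 'M[R[i]]_n := 2%:R^-1 *: (B - B^t*).

Definition conservative_dissipative B : Prop := psdmx (hermpart B).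

(* eigenvalue refers to row eigenvectors; the spectrum is the same. *)
Definition hypocoercive B : Prop :=
  forall z : R[i], eigenvalue B z -> 0 < complex.Re z.

Definition hc_T B m : 'M[R[i]]_n :=
  \sum_(0 <= j < m.+1)
    antihermpart B ^+ j *m hermpart B *m (antihermpart B)^t* ^+ j.

Definition hc_Ttilde2 B m : 'M[R[i]]_n :=
  \sum_(0 <= j < m.+1) B^t* ^+ j *m hermpart B *m B ^+ j.

(* hc_index B m means m_HC(B) = m; m_HC(B) is infinite when no m satisfies it. *)
Definition hc_index B m : Prop :=
  posdefmx (hc_T B m) /\ forall k : nat, posdefmx (hc_T B k) -> (m <= k)%N.

Definition short_time_expansion B (a c eps : R) : Prop :=
  exists2 M : R, 0 < M & forall t : R, 0 <= t < eps ->
    `|opnorm2 (expmx (- (t%:C *: B))) - (1 - c * t `^ a)| <= M * t `^ (a + 1).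

(* The lower bound is for the partial order of R[i], so it forces every element
   of S to be real. *)
Definition is_min (S : set R[i]) (mu : R) : Prop := S mu%:C /\ lbound S mu%:C.

Definition unit_sphere : set 'cV[R[i]]_n := [set x | norm2 x = 1].

Definition kermx_col A : set 'cV[R[i]]_n := [set x | A *m x = 0].

End ComplexMatrices.

(* Main.v *)
Require Import Defs.
From HB Require Import structures.
From mathcomp Require Import all_boot all_order all_algebra.
From mathcomp Require Import complex.
From mathcomp Require Import all_classical all_reals all_analysis.
From mathcomp Require Import ring lra zify.

(** Let [H] be the Hermitian part of [B] and [q(y) = <y, H y>].  Along
    [x' = - B x] one has [d/dt |x|^2 = - 2 q(x)], so a unit vector [x] loses the
    energy
      [1 - |exp(-tB) x|^2 = 2 \int_0^t q(exp(-sB) x) ds],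
    and the operator norm is governed by the least loss over unit vectors.

    The trajectory on [0, t] is expanded in Legendre polynomials.  On Taylor
    coefficients [v_i = (-B)^i x / i!] the integral is the form with Hilbert
    matrix [1 / (i + j + 1)], whose Cholesky factor consists of the moments of
    the shifted Legendre polynomials ([hilbert_cholesky]).  This turns the loss
    into a sum of nonnegative terms ([energy_expansion]),
      [2 t \sum_(k < N) (2k+1) q(w_k) + O(t^(N+1))],
    where [w_k], the k-th Legendre coefficient of the trajectory, equals
    [t^k (k! / (2k+1)!) (-B)^k x + O(t^(k+1))].  Everything is therefore
    polynomial algebra; no integral has to be manipulated.

    Let [m] be the hypocoercivity index and [mu] the minimum of [q(B^m x)] over
    the unit vectors killed by [q(B^j _)] for all [j < m].

    - Every unit vector loses at least
      [2 c t^(2m+1) - O(t^(2m+2))], with [c = (2m+1) (m! / (2m+1)!)^2 mu]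
      ([flow_upper_bound]).  A vector that loses no more than [O(t^(2m+1))] has
      [q(B^k x)^(1/2) = O(t)] for [k < m], hence lies at distance [O(t)] from
      the common kernel ([near_kernel]), where [q(B^m _) >= mu |_|^2]; the
      single term [k = m] of the sum then gives the bound.
    - Some vector loses no more than [2 c t^(2m+1) + O(t^(2m+2))]
      ([flow_lower_bound]).  For [m >= 1] a minimizer [x0] itself loses too much,
      because its trajectory also has components on the Legendre polynomials of
      degree below [m].  A polynomial correction [A(tB) x0], [A(0) = 1], cancels all of them
      up to [O(t^(m+1))]: on [x0] only the monomial [(tB)^m] matters to leading
      order, and the coefficients of [A] solve a triangular system
      ([legendre_dual_poly]).

    Since [(2m+1) (m! / (2m+1)!)^2 = 1 / ((2m+1)! 'C(2m, m))], this is the stated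
    constant.  An expansion [1 - c t^a + O(t^(a+1))] determines [a] and [c]
    ([expansion_unique]).  Finally, [B] is hypocoercive exactly when no nonzero
    vector is killed by all the [q(B^j _)] ([hypocoerciveP]): the common kernel
    is stable under [B] and would contain an eigenvector with purely
    imaginary eigenvalue.  Such a vector would keep the norm at [1 - O(t^N)] for all [N],
    which excludes an expansion with [c > 0] ([expansion_damped]). *)

Set Implicit Arguments.
Unset Strict Implicit.
Unset Printing Implicit Defensive.

Import Order.TTheory GRing.Theory Num.Theory.
Import numFieldNormedType.Exports.

Local Open Scope classical_set_scope.
Local Open Scope ring_scope.
Local Open Scope sesquilinear_scope.

(** * Elementary inequalities *)

Section RealInequalities.
Variable R : realFieldType.
Implicit Types (a b c d e g t w x y D K : R).

Lemma discriminant_le a b c :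
  (forall t, 0 <= a + t * b *+ 2 + t ^+ 2 * c) -> 0 <= c -> b ^+ 2 <= a * c.
Proof.
move=> P c_ge0; have [c0|c0] := eqVneq c 0.
  have [->|b0] := eqVneq b 0; first by rewrite c0 expr0n mulr0.
  have := P (- (a + 1) / (b *+ 2)); rewrite c0 mulr0 addr0.
  have -> : a + - (a + 1) / (b *+ 2) * b *+ 2 = -1 by field.
  by lra.
have c_gt0 : 0 < c by rewrite lt0r c0.
have := P (- b / c); rewrite -(pmulr_lge0 _ c_gt0).
have -> : (a + - b / c * b *+ 2 + (- b / c) ^+ 2 * c) * c = a * c - b ^+ 2.
  by field.
by lra.
Qed.

Lemma sqr_ge_sub a e y : 0 <= a -> 0 <= e -> 0 <= y ->
  a - e <= y -> a ^+ 2 - 2 * a * e <= y ^+ 2.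
Proof.
move=> a0 e0 y0 h; have [ae|ae] := lerP a e; first by nra.
by have : (a - e) ^+ 2 <= y ^+ 2; [rewrite ler_sqr ?nnegrE // subr_ge0 ltW|nra].
Qed.

Lemma sqr_le_add a e y t : 0 <= a -> 0 <= e ->
  0 <= y -> 0 <= t <= 1 -> y <= a + e * t ->
  y ^+ 2 <= a ^+ 2 + (2 * a * e + e ^+ 2) * t.
Proof.
move=> a0 e0 y0 /andP[t0 t1] h.
have : y ^+ 2 <= (a + e * t) ^+ 2.
  by rewrite ler_sqr ?nnegrE // addr_ge0 // mulr_ge0.
move=> /le_trans; apply.
have -> : (a + e * t) ^+ 2 = a ^+ 2 + 2 * a * e * t + e ^+ 2 * t * t by ring.
by rewrite [X in _ <= _ + X]mulrDl addrA lerD2l ler_piMr // mulr_ge0 ?sqr_ge0.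
Qed.

(** Undoes the normalization of an almost unit vector of norm [y]: a loss [w]
    for that vector costs only a relative error [O(t)] after dividing by
    [y ^+ 2]. *)
Lemma normalized_gap D y d w t :
  0 <= D -> 0 <= t -> 4 * D * t <= 1 -> 1 - D * t <= y -> 0 <= w ->
  d * y ^+ 2 <= w -> d <= w * (1 + 4 * D * t).
Proof.
move=> D0 t0 Dt y1 w0 dy.
have Dt0 : 0 <= D * t by rewrite mulr_ge0.
have [d0|d0] := lerP d 0.
  by apply: le_trans d0 _; rewrite mulr_ge0 // addr_ge0 // !mulr_ge0.
have y2 : 1 - 2 * (D * t) <= y ^+ 2.
  by have := @sqr_ge_sub 1 (D * t) y; rewrite expr1n mulr1; apply=> //; lra.
have f0 : 0 <= 1 + 4 * D * t by rewrite addr_ge0 // !mulr_ge0.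
apply: le_trans (_ : d * y ^+ 2 * (1 + 4 * D * t) <= _); last by rewrite ler_wpM2r.
rewrite -mulrA ler_peMr ?(ltW d0) //.
apply: le_trans (_ : (1 - 2 * (D * t)) * (1 + 4 * D * t) <= _); last by rewrite ler_wpM2r.
by nra.
Qed.

(** Replaces [sqrt (1 - w)] by a polynomial; the error [w ^+ 2] is harmless
    because [w] will be of order [t ^+ (2 * m + 1)]. *)
Lemma sqrt_ge_quadratic g w : 0 <= g -> 0 <= w <= 1 -> 1 - w <= g ^+ 2 ->
  1 - w / 2 - w ^+ 2 / 2 <= g.
Proof.
move=> g0 /andP[w0 w1] h; set v := (X in X <= g).
have w2 : w ^+ 2 <= w by rewrite expr2 ler_piMr.
have v0 : 0 <= v by rewrite /v; lra.
have v2 : v ^+ 2 <= 1 - w.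
  have -> : v ^+ 2 = 1 - w - w ^+ 2 + (w + w ^+ 2) ^+ 2 / 4 by rewrite /v; field.
  have h2 : (w + w ^+ 2) ^+ 2 <= (w + w) ^+ 2.
    by rewrite ler_sqr ?nnegrE ?addr_ge0 ?sqr_ge0 // lerD2l.
  have h3 : (w + w) ^+ 2 = 4 * w ^+ 2 by ring.
  by lra.
by rewrite -ler_sqr ?nnegrE //; apply: le_trans h.
Qed.

Lemma le0_small x K : 0 <= K -> (forall eta, 0 < eta -> x <= K * eta) ->
  x <= 0.
Proof.
move=> K0 h; apply/ler_addgt0Pr => e e0.
have K1 : 0 < K + 1 by rewrite ltr_wpDl.
apply: le_trans (h (e / (K + 1)) (divr_gt0 e0 K1)) _.
rewrite add0r mulrA ler_pdivrMr // mulrC ler_wpM2l ?(ltW e0) //.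
by rewrite lerDl.
Qed.

End RealInequalities.

(** * Hermitian forms and their seminorms *)

Section RealPart.
Variable R : realType.
Implicit Types z w : R[i].

Lemma ReD z w : complex.Re (z + w) = complex.Re z + complex.Re w.
Proof. by case: z w => [? ?] [? ?]. Qed.

Lemma Re_realM (t : R) z : complex.Re (t%:C%C * z) = t * complex.Re z.
Proof. by case: z => a b /=; rewrite mul0r subr0. Qed.

Lemma Re_conj z : complex.Re z^* = complex.Re z.
Proof. by case: z. Qed.

Lemma conj_real (t : R) : (t%:C%C)^* = t%:C%C :> R[i].
Proof. by apply/eqP; rewrite eq_complex /= oppr0 !eqxx. Qed.

Lemma Re_sum (I : Type) (r : seq I) (P : pred I) (F : I -> R[i]) :
  complex.Re (\sum_(i <- r | P i) F i) = \sum_(i <- r | P i) complex.Re (F i).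
Proof. by elim/big_rec2: _ => // i x y _ <-; rewrite ReD. Qed.

End RealPart.

(** The underlying real bilinear form of the Hermitian form of [H]; only the real
    part is needed because every quantity of interest is a value on the diagonal.
    The case [H = 1] is the Euclidean structure. *)
HB.lock Definition hform (R : realType) (n : nat) (H : 'M[R[i]]_n)
  (x y : 'cV[R[i]]_n) : R := complex.Re (innerp x (H *m y)).

HB.lock Definition seminorm (R : realType) (n : nat) (H : 'M[R[i]]_n)
  (x : 'cV[R[i]]_n) : R := Num.sqrt (hform H x x).

Section Forms.
Variables (R : realType) (n : nat).
Implicit Types (A H : 'M[R[i]]_n) (x y z : 'cV[R[i]]_n) (t : R).

Lemma innerpE x y : innerp x y = \sum_i x i 0 * (y i 0)^*.
Proof.
rewrite /innerp dotmxE mxE; apply: eq_bigr => i _.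
by rewrite !mxE.
Qed.

Lemma innerp_adj A x y : innerp x (A *m y) = innerp (A^t* *m x) y.
Proof.
rewrite /innerp !dotmxE; congr (fun M : 'M[R[i]]_1 => M 0 0).
by rewrite !trmxK map_mxM trmx_mul -map_trmx trmxK mulmxA.
Qed.

Lemma innerp_conj x y : innerp x y = (innerp y x)^*.
Proof.
rewrite !innerpE rmorph_sum; apply: eq_bigr => i _.
by rewrite rmorphM /= conjCK mulrC.
Qed.

Lemma innerpDl x y z : innerp (x + y) z = innerp x z + innerp y z.
Proof.
by rewrite !innerpE -big_split; apply: eq_bigr => i _; rewrite mxE mulrDl.
Qed.

Lemma innerpZl (a : R[i]) x y : innerp (a *: x) y = a * innerp x y.
Proof.
by rewrite !innerpE mulr_sumr; apply: eq_bigr => i _; rewrite mxE mulrA.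
Qed.

Lemma hformDl H x y z : hform H (x + y) z = hform H x z + hform H y z.
Proof. by rewrite hform.unlock innerpDl ReD. Qed.

Lemma hformZl H t x y : hform H (t%:C%C *: x) y = t * hform H x y.
Proof. by rewrite hform.unlock innerpZl Re_realM. Qed.

Lemma innerpZr (a : R[i]) x y : innerp x (a *: y) = a^* * innerp x y.
Proof.
rewrite !innerpE mulr_sumr; apply: eq_bigr => i _.
by rewrite mxE rmorphM /= mulrCA.
Qed.

Lemma innerpDr x y z : innerp x (y + z) = innerp x y + innerp x z.
Proof.
by rewrite !innerpE -big_split; apply: eq_bigr => i _; rewrite mxE rmorphD mulrDr.
Qed.

Lemma hform_addmx A H x y : hform (A + H) x y = hform A x y + hform H x y.
Proof. by rewrite hform.unlock mulmxDl innerpDr ReD. Qed.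

Lemma hform_scalemx t H x y : hform (t%:C%C *: H) x y = t * hform H x y.
Proof. by rewrite hform.unlock -scalemxAl innerpZr conj_real Re_realM. Qed.

Lemma hform_mulmx A H x y : hform (A *m H) x y = hform A x (H *m y).
Proof. by rewrite hform.unlock mulmxA. Qed.

Lemma hform_trmx_mulmx A H x y : hform (A^t* *m H) x y = hform H (A *m x) y.
Proof. by rewrite hform.unlock -mulmxA innerp_adj trmxCK. Qed.

Lemma hermsymmxP A : reflect (A^t* = A) (A \is hermsymmx).
Proof.
apply: (iffP (is_hermitianmxP _ _ _)) => [|] e; last by rewrite expr0 scale1r e.
by rewrite {2}e expr0 scale1r.
Qed.

Section Hermitian.
Variable H : 'M[R[i]]_n.
Hypothesis H_herm : H \is hermsymmx.

Lemma hermsymmx_adj : H^t* = H.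
Proof. exact/hermsymmxP. Qed.

Lemma hform_sym x y : hform H x y = hform H y x.
Proof. by rewrite hform.unlock innerp_adj hermsymmx_adj innerp_conj Re_conj. Qed.

Lemma hformDr x y z : hform H x (y + z) = hform H x y + hform H x z.
Proof. by rewrite !(hform_sym x) hformDl. Qed.

Lemma hformZr t x y : hform H x (t%:C%C *: y) = t * hform H x y.
Proof. by rewrite !(hform_sym x) hformZl. Qed.

Lemma hform0l y : hform H 0 y = 0.
Proof.
by rewrite -(scale0r (y : 'cV[R[i]]_n)) -(rmorph0 (real_complex R)) hformZl mul0r.
Qed.

Lemma hform_suml (I : Type) (r : seq I) (F : I -> 'cV[R[i]]_n) y :
  hform H (\sum_(i <- r) F i) y = \sum_(i <- r) hform H (F i) y.
Proof. by elim/big_rec2: _ => [|i a b _ <-]; rewrite ?hform0l ?hformDl. Qed.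

Lemma hform_sumr (I : Type) (r : seq I) (F : I -> 'cV[R[i]]_n) x :
  hform H x (\sum_(i <- r) F i) = \sum_(i <- r) hform H x (F i).
Proof.
by rewrite hform_sym hform_suml; apply: eq_bigr => i _; rewrite hform_sym.
Qed.

Lemma innerp_hform x : innerp x (H *m x) = (hform H x x)%:C%C.
Proof.
rewrite hform.unlock RRe_real //; apply/CrealP.
by rewrite {2}innerp_conj innerp_adj hermsymmx_adj.
Qed.

End Hermitian.

Section Semidefinite.
Variable H : 'M[R[i]]_n.
Hypothesis H_psd : psdmx H.
Let Hh : H \is hermsymmx := proj1 H_psd.

Lemma hform_ge0 x : 0 <= hform H x x.
Proof. by have [_ /(_ x)] := H_psd; rewrite innerp_hform // ler0c. Qed.

Lemma hform_CS x y : hform H x y ^+ 2 <= hform H x x * hform H y y.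
Proof.
have P t : 0 <= hform H x x + t * hform H x y *+ 2 + t ^+ 2 * hform H y y.
  have := hform_ge0 (x + t%:C%C *: y).
  rewrite hformDl !(hformDr Hh) !hformZl !(hformZr Hh) (hform_sym Hh y x).
  by rewrite mulrA -expr2 mulr2n !addrA.
exact: discriminant_le P (hform_ge0 y).
Qed.

Local Notation seminorm := (seminorm H).

Lemma seminorm_ge0 x : 0 <= seminorm x.
Proof. by rewrite seminorm.unlock sqrtr_ge0. Qed.

Lemma sqr_seminorm x : seminorm x ^+ 2 = hform H x x.
Proof. by rewrite seminorm.unlock sqr_sqrtr // hform_ge0. Qed.

Lemma seminorm_le x (b : R) : 0 <= b -> hform H x x <= b ^+ 2 -> seminorm x <= b.
Proof.
move=> b0 le.
by rewrite seminorm.unlock -(ger0_norm b0) -sqrtr_sqr ler_sqrt // sqr_ge0.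
Qed.

Lemma hform_le_seminorm x y : `|hform H x y| <= seminorm x * seminorm y.
Proof.
rewrite seminorm.unlock -sqrtr_sqr -sqrtrM; last exact: hform_ge0.
apply: ler_wsqrtr; exact: hform_CS.
Qed.

Lemma seminormD x y : seminorm (x + y) <= seminorm x + seminorm y.
Proof.
apply: seminorm_le; first by apply: addr_ge0; exact: seminorm_ge0.
rewrite sqrrD !sqr_seminorm hformDl !(hformDr Hh) (hform_sym Hh y x).
have := le_trans (ler_norm _) (hform_le_seminorm x y).
move: (hform H x y) (hform H x x) (hform H y y) (seminorm x * seminorm y) => a b c d.
by rewrite mulr2n; lra.
Qed.

Lemma seminormZ (a : R[i]) x :
  seminorm (a *: x) = complex.Re `|a| * seminorm x.
Proof.
have fZ : hform H (a *: x) (a *: x) = complex.Re `|a| ^+ 2 * hform H x x.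
  apply: complexI; rewrite -innerp_hform //.
  rewrite [RHS](rmorphM (real_complex R)) -[X in _ * X](innerp_hform Hh) -scalemxAr.
  rewrite innerpZl innerpZr mulrA.
  congr (_ * _); rewrite -normCK -[in LHS](RRe_real (normr_real a)).
  exact: esym (rmorphXn (real_complex R) _ _).
rewrite seminorm.unlock fZ sqrtrM ?sqr_ge0 // sqrtr_sqr ger0_norm //.
by have := normr_ge0 a; rewrite lecE => /andP[].
Qed.

Lemma seminormZr t x : seminorm (t%:C%C *: x) = `|t| * seminorm x.
Proof. by rewrite seminormZ normc_def /= expr0n addr0 sqrtr_sqr. Qed.

Lemma seminormN x : seminorm (- x) = seminorm x.
Proof.
by rewrite -scaleN1r -(rmorph1 (real_complex R)) -rmorphN seminormZr normrN1 mul1r.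
Qed.

Lemma seminorm0 : seminorm 0 = 0.
Proof. by rewrite seminorm.unlock hform0l // sqrtr0. Qed.

Lemma seminorm_sum (I : Type) (r : seq I) (P : pred I) (F : I -> 'cV[R[i]]_n) :
  seminorm (\sum_(i <- r | P i) F i) <= \sum_(i <- r | P i) seminorm (F i).
Proof.
elim/big_rec2: _ => [|i a b _ h]; first by rewrite seminorm0.
by apply: le_trans (seminormD _ _) _; rewrite lerD2l.
Qed.

Lemma ler_seminormB x y : seminorm x - seminorm y <= seminorm (x - y).
Proof. by rewrite lerBlDr -{1}(subrK y x) seminormD. Qed.

(** Cauchy-Schwarz makes an isotropic vector orthogonal to everything, in
    particular to [H *m x]. *)
Lemma seminorm_eq0 x : seminorm x = 0 -> H *m x = 0.
Proof.
move=> p0; have h0 y : hform H y x = 0.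
  have := hform_le_seminorm y x; rewrite p0 mulr0 => h.
  by apply/eqP; rewrite -normr_eq0 eq_le h normr_ge0.
apply/eqP; move: (h0 (H *m x)); rewrite hform.unlock.
have [//|ne] := eqVneq (H *m x) 0; move=> e0.
have : 0 < innerp (H *m x) (H *m x).
  by rewrite /innerp dnorm_gt0 trmx_eq0.
by rewrite ltcE e0 /= ltxx andbF.
Qed.

Lemma ker_seminorm x : H *m x = 0 -> seminorm x = 0.
Proof.
move=> e; rewrite seminorm.unlock hform.unlock e -(scale0r x) innerpZr.
by rewrite conjC0 mul0r sqrtr0.
Qed.

End Semidefinite.

Lemma psdmx1 : psdmx (1%:M : 'M[R[i]]_n).
Proof.
split; first exact: hermitian1mx_subproof.
by move=> x; rewrite mul1mx /innerp dnorm_ge0.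
Qed.

Lemma norm2_seminorm x : norm2 x = seminorm 1%:M x.
Proof. by rewrite /norm2 seminorm.unlock hform.unlock mul1mx. Qed.

End Forms.

Local Notation vnorm := (seminorm 1%:M).

(** * Bounds for complex matrices *)

Section ComplexModulus.
Variable R : realType.
Implicit Types z w : R[i].

Definition modulus z : R := complex.Re `|z|.

Lemma modulusC z : (modulus z)%:C%C = `|z|.
Proof. by rewrite /modulus RRe_real // normr_real. Qed.

Lemma modulus_ge0 z : 0 <= modulus z.
Proof. by rewrite -ler0c modulusC. Qed.

Lemma modulusD z w : modulus (z + w) <= modulus z + modulus w.
Proof.
rewrite -lecR modulusC (rmorphD (real_complex R)).
by have := ler_normD z w; rewrite -!modulusC.
Qed.

Lemma modulusM z w : modulus (z * w) = modulus z * modulus w.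
Proof.
apply: complexI; rewrite modulusC normrM -!modulusC.
exact: esym (rmorphM (real_complex R) _ _).
Qed.

Lemma modulus_real (t : R) : modulus t%:C%C = `|t|.
Proof. by rewrite /modulus normc_def /= expr0n addr0 sqrtr_sqr. Qed.

Lemma modulus_sum (I : Type) (r : seq I) (F : I -> R[i]) :
  modulus (\sum_(i <- r) F i) <= \sum_(i <- r) modulus (F i).
Proof.
elim/big_rec2: _ => [|i a b _ h]; first by rewrite /modulus normr0.
by apply: le_trans (modulusD _ _) _; rewrite lerD2l.
Qed.

Lemma modulus_leReIm z : modulus z <= `|complex.Re z| + `|complex.Im z|.
Proof.
rewrite /modulus normc_def /= -[leRHS]ger0_norm ?addr_ge0 // -sqrtr_sqr.
apply: ler_wsqrtr; rewrite sqrrD !real_normK ?num_real // lerD2r lerDl.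
by rewrite mulrn_wge0 ?mulr_ge0.
Qed.

Lemma Re_le_modulus z : `|complex.Re z| <= modulus z.
Proof.
rewrite /modulus normc_def /= -sqrtr_sqr; apply: ler_wsqrtr.
by rewrite lerDl sqr_ge0.
Qed.

Lemma Im_le_modulus z : `|complex.Im z| <= modulus z.
Proof.
rewrite /modulus normc_def /= -sqrtr_sqr; apply: ler_wsqrtr.
by rewrite lerDr sqr_ge0.
Qed.

Lemma Im_sum (I : Type) (r : seq I) (P : pred I) (F : I -> R[i]) :
  complex.Im (\sum_(i <- r | P i) F i) = \sum_(i <- r | P i) complex.Im (F i).
Proof.
by elim/big_rec2: _ => // i x y _ <-; case: (F i) y => ? ? [].
Qed.

End ComplexModulus.

Section MatrixBounds.
Variables (R : realType) (n : nat).
Implicit Types (A H : 'M[R[i]]_n) (x y : 'cV[R[i]]_n).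

Lemma seminorm_basis_le H (m : nat) (r : 'I_m -> 'cV[R[i]]_n) (c : 'I_m -> R[i])
    (b : R) : psdmx H -> (forall j, modulus (c j) <= b) ->
  seminorm H (\sum_j c j *: r j) <= (\sum_j seminorm H (r j)) * b.
Proof.
move=> H_psd cb; apply: le_trans (seminorm_sum H_psd _ _ _) _.
rewrite mulr_suml; apply: ler_sum => j _; rewrite (seminormZ H_psd) mulrC.
by apply: ler_wpM2l; [exact: seminorm_ge0|exact: cb].
Qed.

Lemma colE_sum x : x = \sum_j x j 0 *: delta_mx j 0.
Proof. by rewrite [LHS]matrix_sum_delta; apply: eq_bigr => j _; rewrite big_ord1. Qed.

Lemma vnorm_sqr x : vnorm x ^+ 2 = \sum_i modulus (x i 0) ^+ 2.
Proof.
rewrite sqr_seminorm; last exact: psdmx1.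
rewrite hform.unlock mul1mx innerpE Re_sum; apply: eq_bigr => i _.
by rewrite -normCK -modulusC -(rmorphXn (real_complex R)).
Qed.

Lemma vnorm_ge0 x : 0 <= vnorm x.
Proof. exact: seminorm_ge0. Qed.

Lemma coord_le_vnorm x i : modulus (x i 0) <= vnorm x.
Proof.
rewrite -(ger0_norm (modulus_ge0 (x i 0))) -[leRHS]ger0_norm ?vnorm_ge0 //.
rewrite -!sqrtr_sqr vnorm_sqr; apply: ler_wsqrtr.
by rewrite (bigD1 i) //= lerDl sumr_ge0 // => j _; rewrite sqr_ge0.
Qed.

Lemma seminorm_bounded H : psdmx H ->
  exists2 C, 0 <= C & forall x, seminorm H x <= C * vnorm x.
Proof.
move=> H_psd; exists (\sum_j seminorm H (delta_mx j 0)).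
  by apply: sumr_ge0 => j _; exact: seminorm_ge0.
move=> x; rewrite {1}(colE_sum x); apply: seminorm_basis_le => // j.
exact: coord_le_vnorm.
Qed.

Lemma vnorm_delta j : vnorm (delta_mx j 0 : 'cV[R[i]]_n) = 1.
Proof.
rewrite -[LHS]ger0_norm ?vnorm_ge0 // -sqrtr_sqr vnorm_sqr.
rewrite (bigD1 j) //= big1 => [|i ij]; rewrite mxE ?(negPf ij) ?eqxx /=.
  by rewrite addr0 (modulus_real 1) normr1 expr1n sqrtr1.
by rewrite (modulus_real 0) normr0 expr0n.
Qed.

Lemma vnorm_mulmx_entry_le A (e : R) x : (forall i j, modulus (A i j) <= e) ->
  vnorm (A *m x) <= n%:R ^+ 2 * e * vnorm x.
Proof.
move=> Ae; have -> : A *m x = \sum_j x j 0 *: col j A.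
  apply/colP => i; rewrite mxE summxE; apply: eq_bigr => j _.
  by rewrite !mxE mulrC.
apply: le_trans (seminorm_basis_le _ (psdmx1 _ _) (coord_le_vnorm x)) _.
apply: ler_wpM2r; first exact: vnorm_ge0.
have cb j : seminorm 1%:M (col j A) <= n%:R * e.
  rewrite (colE_sum (col j A)).
  have ce i : modulus (col j A i 0) <= e by rewrite mxE.
  apply: le_trans (seminorm_basis_le _ (psdmx1 _ _) ce) _.
  rewrite (eq_bigr (fun=> 1)) ?sumr_const ?card_ord // => i _.
  by rewrite vnorm_delta.
apply: le_trans (ler_sum _ (fun j _ => cb j)) _.
by rewrite sumr_const card_ord -[leLHS]mulr_natl mulrA expr2.
Qed.

(** A submultiplicative bound for all the entries, and homogeneous, so that the
    powers of [t] can be read off the exponential series of [t B]. *)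
Definition mxsum A : R := \sum_i \sum_j modulus (A i j).

Lemma mxsum_ge0 A : 0 <= mxsum A.
Proof. by do 2!apply: sumr_ge0 => ? _; exact: modulus_ge0. Qed.

Lemma coord_le_mxsum A i j : modulus (A i j) <= mxsum A.
Proof.
rewrite /mxsum (bigD1 i) //= (bigD1 j) //= -addrA lerDl addr_ge0 //.
  by apply: sumr_ge0 => ? _; exact: modulus_ge0.
by do 2!apply: sumr_ge0 => ? _; exact: modulus_ge0.
Qed.

Lemma mulmx_bounded A : exists2 C, 0 <= C & forall x, vnorm (A *m x) <= C * vnorm x.
Proof.
exists (n%:R ^+ 2 * mxsum A); last first.
  by move=> x; apply: vnorm_mulmx_entry_le => i j; exact: coord_le_mxsum.
by rewrite mulr_ge0 ?mxsum_ge0 ?exprn_ge0.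
Qed.

Lemma coord_exp_le A (k : nat) i j : modulus ((A ^+ k) i j) <= mxsum A ^+ k.
Proof.
elim: k i j => [|k IHk] i j.
  rewrite !expr0 mxE -(rmorph_nat (real_complex R)) modulus_real ger0_norm //.
  by rewrite lern1 leq_b1.
rewrite exprS mxE; apply: le_trans (modulus_sum _ _) _.
rewrite exprS; apply: le_trans (_ : \sum_j0 modulus (A i j0) * mxsum A ^+ k <= _).
  apply: ler_sum => l _; rewrite modulusM; apply: ler_wpM2l => //.
  exact: modulus_ge0.
rewrite -mulr_suml; apply: ler_wpM2r; first exact: exprn_ge0 (mxsum_ge0 _).
rewrite /mxsum [leRHS](bigD1 i) //= lerDl.
by do 2!apply: sumr_ge0 => ? _; exact: modulus_ge0.
Qed.

End MatrixBounds.

(** * The matrix exponential and its Taylor remainder *)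

Section ExponentialSeries.
Variable R : realType.

Lemma real_series_tail (u b : R ^nat) : (forall k, `|u k| <= b k) ->
  cvgn (series b) ->
  forall N, `|limn (series u) - series u N| <= limn (series b) - series b N.
Proof.
move=> ub cb N.
have b_ge0 k : 0 <= b k by apply: le_trans (ub k).
have cu : cvgn (series u).
  by apply: normed_cvg; apply: series_le_cvg cb => // k /=.
have nb : nondecreasing_seq (series b).
  move=> p q pq; rewrite -subr_ge0 sub_series_geq //.
  by apply: sumr_ge0.
have cn : `|series u M - series u N| @[M --> \oo] -->
    `|limn (series u) - series u N|.
  by apply: cvg_norm; apply: cvgB => //; exact: cvg_cst.
apply: (cvgr_to_le cn); exists N => // M /= NM.
rewrite sub_series_geq //; apply: le_trans (ler_norm_sum _ _ _) _.
apply: le_trans (ler_sum _ (fun k _ => ub k)) _.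
by rewrite -sub_series_geq // lerB // nondecreasing_cvgn_le.
Qed.

(** Stating convergence as a tail bound gives at once the limit and the Taylor
    remainder; real and imaginary parts are summed separately, whence the
    factor 2. *)
Lemma complex_series_tail (u : R[i] ^nat) (b : R ^nat) :
  (forall k, modulus (u k) <= b k) -> cvgn (series b) ->
  exists L : R[i], forall N, modulus (L - \sum_(0 <= k < N) u k) <=
    2 * (limn (series b) - series b N).
Proof.
move=> ub cb; exists (limn (series (fun k => complex.Re (u k))) +i*
  limn (series (fun k => complex.Im (u k))))%C => N.
apply: le_trans (modulus_leReIm _) _; rewrite mulr_natl mulr2n; apply: lerD.
  have -> : complex.Re ((limn (series (fun k => complex.Re (u k))) +i*
    limn (series (fun k => complex.Im (u k))))%C - \sum_(0 <= k < N) u k)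
    = limn (series (fun k => complex.Re (u k))) - series (fun k => complex.Re (u k)) N.
    by rewrite ReD /= /series /= -Re_sum; case: (\sum_(0 <= k < N) u k).
  by apply: real_series_tail => // k; apply: le_trans (Re_le_modulus _) (ub k).
have -> : complex.Im ((limn (series (fun k => complex.Re (u k))) +i*
    limn (series (fun k => complex.Im (u k))))%C - \sum_(0 <= k < N) u k)
    = limn (series (fun k => complex.Im (u k))) - series (fun k => complex.Im (u k)) N.
  by rewrite /series /= -Im_sum; case: (\sum_(0 <= k < N) u k).
by apply: real_series_tail => // k; apply: le_trans (Im_le_modulus _) (ub k).
Qed.

(** Since [t <= 1], every power beyond the [N]-th carries a factor [t ^+ N]. *)
Lemma expR_tail (a t : R) N : 0 <= a -> 0 <= t <= 1 ->
  expR (t * a) - series (exp_coeff (t * a)) N <= t ^+ N * expR a.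
Proof.
move=> a_ge0 /andP[t_ge0 t_le1].
have cn : series (exp_coeff (t * a)) M - series (exp_coeff (t * a)) N @[M --> \oo]
   --> expR (t * a) - series (exp_coeff (t * a)) N.
  by apply: cvgB; [exact: is_cvg_series_exp_coeff|exact: cvg_cst].
apply: (cvgr_to_le cn); exists N => // M /= NM.
have nb : nondecreasing_seq (series (exp_coeff a)).
  by move=> p q pq; rewrite -subr_ge0 sub_series_geq // sumr_ge0 // => k _;
    exact: exp_coeff_ge0.
rewrite sub_series_geq //.
apply: le_trans (_ : \sum_(N <= k < M) t ^+ N * exp_coeff a k <= _).
  rewrite !big_nat; apply: ler_sum => k /andP[Nk _].
  rewrite /exp_coeff /= exprMn mulrA; apply: ler_wpM2r; first by rewrite invr_ge0.
  apply: ler_wpM2r; first exact: exprn_ge0.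
  exact: ler_wiXn2l.
rewrite -mulr_sumr; apply: ler_wpM2l; first exact: exprn_ge0.
rewrite -sub_series_geq //.
apply: le_trans (nondecreasing_cvgn_le nb (is_cvg_series_exp_coeff a) M).
rewrite lerBlDr lerDl; apply: sumr_ge0 => k _; exact: exp_coeff_ge0.
Qed.

Lemma expmx_entry (n : nat) (X : 'M[R[i]]_n) (N : nat) i j :
  modulus ((expmx X - \sum_(0 <= k < N) (k`!%:R)^-1 *: X ^+ k) i j) <=
  2 * (expR (mxsum X) - series (exp_coeff (mxsum X)) N).
Proof.
pose u i j k := (k`!%:R)^-1 * (X ^+ k) i j.
have ub i' j' k : modulus (u i' j' k) <= exp_coeff (mxsum X) k.
  rewrite /u modulusM -(rmorph_nat (real_complex R)) -fmorphV modulus_real.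
  rewrite ger0_norm ?invr_ge0 // /exp_coeff /= mulrC; apply: ler_wpM2r.
    by rewrite invr_ge0.
  exact: coord_exp_le.
have cb := is_cvg_series_exp_coeff (mxsum X).
have [L HL] := choice (fun ij => complex_series_tail (ub ij.1 ij.2) cb).
pose Lm : 'M[R[i]]_n := \matrix_(i, j) L (i, j).
have serE M i' j' : (\sum_(0 <= k < M) (k`!%:R)^-1 *: X ^+ k) i' j' =
    \sum_(0 <= k < M) u i' j' k.
  by rewrite summxE; apply: eq_bigr => k _; rewrite mxE.
suff -> : expmx X = Lm.
  by rewrite mxE [X in _ + X]mxE serE mxE; exact: (HL (i, j)).
apply: cvg_lim; first exact: norm_hausdorff.
apply/cvg_ballP => e e_gt0.
have e_real : (complex.Re e)%:C%C = e by rewrite RRe_real // gtr0_real.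
have re_gt0 : 0 < complex.Re e by rewrite -ltcR e_real.
have : (2 * (expR (mxsum X) - series (exp_coeff (mxsum X)) M)) @[M --> \oo]
    --> 2 * (expR (mxsum X) - expR (mxsum X)).
  by apply: cvgM; [exact: cvg_cst|apply: cvgB => //; exact: cvg_cst].
rewrite subrr mulr0 => /cvgr_lt /(_ _ re_gt0); apply: filterS => M ltM.
split => // i' j'; rewrite /ball /= -modulusC -e_real ltcR.
apply: le_lt_trans ltM; rewrite /series /= serE mxE; exact: (HL (i', j')).
Qed.

End ExponentialSeries.

(** * Legendre moments and the Hilbert matrix *)

Section HilbertMatrix.
Variable R : realFieldType.
Implicit Types i j k N : nat.

Let factR k : k`!%:R != 0 :> R.
Proof. by rewrite pnatr_eq0 -lt0n fact_gt0. Qed.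

(** The reciprocal of [(i - k)!], extended by 0, as usual for reciprocals of
    factorials of negative integers; this makes [inv_fact_subS] hold without
    side conditions. *)
Definition inv_fact_sub i k : R := if (k <= i)%N then (i - k)`!%:R^-1 else 0.

Lemma inv_fact_subS i k :
  inv_fact_sub i k.+1 = (i%:R - k%:R) * inv_fact_sub i k.
Proof.
rewrite /inv_fact_sub; case: (ltngtP k i) => [ki|ki|->].
- rewrite -natrB ?(ltnW ki) // subnS; case: (i - k)%N (subn_gt0 k i) => [|p _].
    by rewrite ki.
  by rewrite /= factS natrM invfM mulVKf // pnatr_eq0.
- by rewrite mulr0.
- by rewrite subrr mul0r.
Qed.

(** The integral over [0, 1] of [s ^+ i] against the [k]-th shifted Legendre
    polynomial. *)
Definition legendre_moment k i : R :=
  i`!%:R ^+ 2 * inv_fact_sub i k / (i + k).+1`!%:R.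

Lemma legendre_moment_lt k i : (i < k)%N -> legendre_moment k i = 0.
Proof.
by move=> ik; rewrite /legendre_moment /inv_fact_sub leqNgt ik mulr0 mul0r.
Qed.

Lemma legendre_moment_diag k :
  legendre_moment k k = k`!%:R ^+ 2 / (2 * k + 1)`!%:R.
Proof.
by rewrite /legendre_moment /inv_fact_sub leqnn subnn invr1 mulr1 addnn -mul2n addn1.
Qed.

(** As the shifted Legendre polynomials are orthogonal with squared norms
    [(2 * k + 1)^-1], this is Parseval's identity for the monomials of degrees
    [i] and [j].  The sum telescopes: [stepG] comes from
    [(i + k + 1) (j + k + 1) - (i - k) (j - k) = (2 * k + 1) (i + j + 1)]. *)
Lemma hilbert_cholesky N i j : (i < N)%N ->
  \sum_(k < N) (2 * k + 1)%:R * (legendre_moment k i * legendre_moment k j) =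
  (i + j + 1)%:R^-1.
Proof.
move=> iN.
pose G k : R := (i`!%:R * j`!%:R) ^+ 2 * inv_fact_sub i k * inv_fact_sub j k /
  ((i + k)`!%:R * (j + k)`!%:R) / (i + j + 1)%:R.
have stepG k : (2 * k + 1)%:R * (legendre_moment k i * legendre_moment k j) =
    - (G k.+1 - G k).
  rewrite /G !inv_fact_subS /legendre_moment !addnS !factS !natrM.
  have := factR (i + k); have := factR (j + k).
  have nz p : p.+1%:R != 0 :> R by rewrite pnatr_eq0.
  have := nz (i + k)%N; have := nz (j + k)%N; have := nz (i + j)%N.
  have natrS p : p.+1%:R = p%:R + 1 :> R by rewrite -natr1.
  rewrite !addn0 !natrS (natrM _ 2 k) !natrD.
  move: (inv_fact_sub i k) (inv_fact_sub j k) (i`!%:R) (j`!%:R) => a b c d.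
  move: ((i + k)`!%:R) ((j + k)`!%:R) => e f h1 h2 h3 h4 h5.
  by field; rewrite h1 h2 h3 h4 h5.
under eq_bigr do rewrite stepG.
rewrite sumrN -(big_mkord xpredT (fun k => G k.+1 - G k)) telescope_sumr //.
rewrite opprB /G !addn0 {3}/inv_fact_sub leqNgt iN /= mulr0 !mul0r subr0.
rewrite /inv_fact_sub !leq0n !subn0.
have := factR i; have := factR j => h1 h2.
have h3 : (i + j + 1)%:R != 0 :> R by rewrite pnatr_eq0 addn1.
move: (i`!%:R) (j`!%:R) ((i + j + 1)%:R) h1 h2 h3 => a b c h1 h2 h3.
by field; rewrite h1 h2 h3.
Qed.

(** The energy balance for a truncated Taylor series, with [g i j] the inner
    product of the Taylor coefficients [i] and [j] and [h] the dissipated form.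
    Up to degree [N] every [t ^+ (i + j) * g i j] is recovered with weight
    [j / (i + j)] from one term of the dissipation and [i / (i + j)] from
    another.  On the border [j = N] only one of the two is present; the missing
    weight [i / (i + N)] vanishes for [i = 0], so the defect has order
    [t ^+ N.+1]. *)
Lemma energy_sum (g h : nat -> nat -> R) (t : R) N : (0 < N)%N ->
  (forall i j, 2 * h i j = - (j.+1%:R * g i j.+1) - i.+1%:R * g i.+1 j) ->
  \sum_(i < N.+1) \sum_(j < N.+1) t ^+ (i + j) * g i j =
  g 0%N 0%N
  - \sum_(i < N) \sum_(j < N) 2 * t ^+ (i + j + 1) / (i + j + 1)%:R * h i j
  + \sum_(i < N) i%:R / (i + N)%:R * t ^+ (i + N) * (g i N + g N i)
  + t ^+ (N + N) * g N N.
Proof.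
move=> N_gt0 gh; pose G i j := t ^+ (i + j) * g i j.
pose F i j := j%:R / (i + j)%:R * G i j.
pose F' i j := i%:R / (i + j)%:R * G i j.
have hE i j : 2 * t ^+ (i + j + 1) / (i + j + 1)%:R * h i j =
    - F i j.+1 - F' i.+1 j.
  rewrite -[LHS]/(2 * t ^+ (i + j + 1) / (i + j + 1)%:R * h i j).
  have -> : 2 * t ^+ (i + j + 1) / (i + j + 1)%:R * h i j =
    t ^+ (i + j + 1) / (i + j + 1)%:R * (2 * h i j) by ring.
  by rewrite gh /F /F' /G !addnS !addSn !addn0; ring.
have shift (f : nat -> R) : f 0%N = 0 ->
    \sum_(j < N) f j.+1 = \sum_(j < N) f j + f N.
  move=> f0; elim: (N) => [|M IH]; first by rewrite !big_ord0 f0 addr0.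
  by rewrite !big_ord_recr /= IH.
have sF (i : nat) : \sum_(j < N) F i j.+1 = \sum_(j < N) F i j + F i N.
  by apply: (shift (F i)); rewrite /F !mul0r.
have sF' (j : nat) : \sum_(i < N) F' i.+1 j = \sum_(i < N) F' i j + F' N j.
  by apply: (shift (F'^~ j)); rewrite /F' !mul0r.
have -> : \sum_(i < N) \sum_(j < N) 2 * t ^+ (i + j + 1) / (i + j + 1)%:R * h i j
  = - (\sum_(i < N) \sum_(j < N) (F i j + F' i j)
       + \sum_(i < N) (F i N + F' N i)).
  under eq_bigr => i _ do (under eq_bigr => j _ do rewrite hE).
  under eq_bigr => i _ do rewrite big_split /= !sumrN sF.
  rewrite big_split /= !sumrN exchange_big /=.
  under [X in _ - X]eq_bigr => j _ do rewrite sF'.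
  rewrite !big_split /= -opprD; congr (- _).
  under [in RHS]eq_bigr => i _ do rewrite big_split.
  rewrite [in RHS]big_split /= [\sum_(i < N) \sum_(j < N) F' j i]exchange_big /=; ring.
have FF (i j : nat) : F i j + F' i j = if (i + j == 0)%N then 0 else G i j.
  rewrite /F /F' -!mulrDl -natrD addnC.
  case: eqP => [->|/eqP ij]; first by rewrite mul0r mul0r.
  by rewrite divff ?mul1r // pnatr_eq0.
have -> : \sum_(i < N) \sum_(j < N) (F i j + F' i j) =
    \sum_(i < N) \sum_(j < N) G i j - g 0%N 0%N.
  case: N N_gt0 {shift sF sF'} => // N _.
  rewrite !big_ord_recl /= FF /= add0r.
  rewrite [G 0%N 0%N]/G expr0 mul1r.
  under eq_bigr do rewrite FF /=.
  under [X in _ + X]eq_bigr => i _ do (under eq_bigr do rewrite FF /=).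
  by ring.
rewrite -/(G _ _) big_ord_recr /= [X in _ + X = _]big_ord_recr /=.
under eq_bigr => i _ do rewrite big_ord_recr /=.
rewrite big_split /= -/(G N N).
have -> : \sum_(i < N) i%:R / (i + N)%:R * t ^+ (i + N) * (g i N + g N i) =
  \sum_(i < N) G i N + \sum_(i < N) G N i - \sum_(i < N) (F i N + F' N i).
  rewrite -big_split -sumrB /=; apply: eq_bigr => i _.
  rewrite /F /F' /G [(N + i)%N]addnC.
  have nz : (i + N)%:R != 0 :> R by rewrite pnatr_eq0 -lt0n addn_gt0 N_gt0 orbT.
  move: nz; rewrite natrD => nz; by field.
rewrite -[\sum_(i < N) \sum_(j < N) t ^+ (i + j) * g i j]/(\sum_(i < N)
  \sum_(j < N) G i j).
rewrite -[\sum_(i < N) t ^+ (i + N) * g i N]/(\sum_(i < N) G i N).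
rewrite -[\sum_(i < N) t ^+ (N + i) * g N i]/(\sum_(i < N) G N i).
ring.
Qed.

End HilbertMatrix.

(** * Polynomials in tB acting on vectors *)

Section PolynomialAction.
Variables (R : realType) (n' : nat).
Local Notation n := n'.+1.
Variable B : 'M[R[i]]_n.
Implicit Types (P Q : {poly R}) (x y : 'cV[R[i]]_n) (t : R) (k m N : nat).

Definition polyact t P : 'M[R[i]]_n :=
  horner_mx (t%:C%C *: B) (map_poly (real_complex R) P).

Lemma polyactE t P N : (size P <= N)%N ->
  polyact t P = \sum_(i < N) (P`_i * t ^+ i)%:C%C *: B ^+ i.
Proof.
move=> PN; rewrite /polyact /horner_mx /horner_morph.
rewrite (@horner_coef_wide _ N); last first.
  by rewrite (leq_trans (size_poly _ _)) // (leq_trans (size_poly _ _)).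
apply: eq_bigr => i _; rewrite !coef_map /= exprZn.
rewrite -mulmxE mul_scalar_mx scalerA; congr (_ *: _).
by rewrite (rmorphM (real_complex R)) (rmorphXn (real_complex R)).
Qed.

Lemma polyactM t P Q x :
  polyact t P *m (polyact t Q *m x) = polyact t (P * Q) *m x.
Proof. by rewrite mulmxA /polyact (rmorphM (map_poly _)) (rmorphM (horner_mx _)). Qed.

Lemma polyactB t P Q : polyact t (P - Q) = polyact t P - polyact t Q.
Proof. by rewrite /polyact (rmorphB (map_poly _)) (rmorphB (horner_mx _)). Qed.

Lemma polyact_mulE t P N x : (size P <= N)%N ->
  polyact t P *m x = \sum_(i < N) (P`_i * t ^+ i)%:C%C *: (B ^+ i *m x).
Proof.
move=> /(polyactE t) ->; rewrite mulmx_suml.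
by apply: eq_bigr => i _; rewrite scalemxAl.
Qed.

Section Seminorm.
Variable H : 'M[R[i]]_n.
Hypothesis H_psd : psdmx H.

Lemma seminorm_polyact_le t P N x : 0 <= t -> (size P <= N)%N ->
  seminorm H (polyact t P *m x) <=
  \sum_(i < N) `|P`_i| * t ^+ i * seminorm H (B ^+ i *m x).
Proof.
move=> t0 /(polyact_mulE t) ->; apply: le_trans (seminorm_sum H_psd _ _ _) _.
apply: ler_sum => i _; rewrite (seminormZr H_psd) normrM [`|t ^+ i|]ger0_norm //.
exact: exprn_ge0.
Qed.

Lemma seminorm_mulmx_bounded (A : 'M[R[i]]_n) :
  exists2 C, 0 <= C & forall x, seminorm H (A *m x) <= C * vnorm x.
Proof.
have [C C0 HC] := seminorm_bounded H_psd; have [D D0 HD] := mulmx_bounded A.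
exists (C * D) => [|x]; first exact: mulr_ge0.
by apply: le_trans (HC _) _; rewrite -mulrA ler_wpM2l.
Qed.

(** A monomial may be dropped either because its coefficient is 0 or because
    the seminorm does not see the corresponding power of [B]; both situations
    occur below. *)
Lemma seminorm_polyact_order P m : exists2 C, 0 <= C &
  forall t x, 0 <= t <= 1 ->
  (forall i, (i < m)%N -> P`_i = 0 \/ seminorm H (B ^+ i *m x) = 0) ->
  seminorm H (polyact t P *m x) <= C * t ^+ m * vnorm x.
Proof.
have /choice[C HC] : forall i : nat, exists C, 0 <= C /\
    forall x, seminorm H (B ^+ i *m x) <= C * vnorm x.
  by move=> i; have [C C0 HC] := seminorm_mulmx_bounded (B ^+ i); exists C.
have C_ge0 i : 0 <= C i by have [] := HC i.
exists (\sum_(i < size P) `|P`_i| * C i).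
  by apply: sumr_ge0 => i _; apply: mulr_ge0.
move=> t x /andP[t0 t1] van.
apply: le_trans (seminorm_polyact_le x t0 (leqnn _)) _.
rewrite !mulr_suml; apply: ler_sum => i _.
have [im|mi] := ltnP i m.
  have -> : `|P`_i| * t ^+ i * seminorm H (B ^+ i *m x) = 0.
    by have [->|->] := van _ im; rewrite ?normr0 ?mulr0 ?mul0r.
  by rewrite !mulr_ge0 ?exprn_ge0 ?vnorm_ge0.
rewrite -!mulrA; apply: ler_wpM2l => //.
apply: le_trans (_ : t ^+ m * (C i * vnorm x) <= _); last by rewrite mulrCA.
by apply: ler_pM; rewrite ?exprn_ge0 ?seminorm_ge0 ?ler_wiXn2l //; have [] := HC i.
Qed.

(** Only the first surviving monomial counts to leading order: subtract it and
    apply [seminorm_polyact_order] to the rest. *)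
Lemma seminorm_polyact_lead P m : exists2 C, 0 <= C &
  forall t x, 0 <= t <= 1 ->
  (forall i, (i < m)%N -> P`_i = 0 \/ seminorm H (B ^+ i *m x) = 0) ->
  `|seminorm H (polyact t P *m x) - `|P`_m| * t ^+ m * seminorm H (B ^+ m *m x)|
     <= C * t ^+ m.+1 * vnorm x.
Proof.
pose Q := P - P`_m *: 'X^m.
have [C C0 HC] := seminorm_polyact_order Q m.+1; exists C => // t x t01 van.
have vanQ i : (i < m.+1)%N -> Q`_i = 0 \/ seminorm H (B ^+ i *m x) = 0.
  rewrite ltnS leq_eqVlt /Q coefB coefZ coefXn => /orP[/eqP->|im].
    by left; rewrite eqxx mulr1 subrr.
  by rewrite (ltn_eqF im) mulr0 subr0; exact: van.
have := HC t x t01 vanQ; rewrite /Q polyactB mulmxBl.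
have -> : polyact t (P`_m *: 'X^m) *m x = (P`_m * t ^+ m)%:C%C *: (B ^+ m *m x).
  rewrite (polyact_mulE _ _ (leq_trans (size_scale_leq _ _) (eq_leq (size_polyXn _ _)))).
  rewrite (bigD1 ord_max) //= coefZ coefXn eqxx mulr1 big1 ?addr0 // => i.
  rewrite -val_eqE /= => /negPf im; rewrite coefZ coefXn im mulr0 mul0r.
  by rewrite (rmorph0 (real_complex R)) scale0r.
have -> : `|P`_m| * t ^+ m * seminorm H (B ^+ m *m x) =
   seminorm H ((P`_m * t ^+ m)%:C%C *: (B ^+ m *m x)).
  rewrite (seminormZr H_psd) normrM [`|t ^+ m|]ger0_norm // exprn_ge0 //.
  by case/andP: t01.
apply: le_trans; rewrite ler_norml; apply/andP; split; last exact: ler_seminormB.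
rewrite lerNl opprB -(seminormN H_psd (_ - _)) opprB; exact: ler_seminormB.
Qed.

End Seminorm.

Lemma vnorm_polyact_bounded P : exists2 C, 0 <= C &
  forall t x, 0 <= t <= 1 -> vnorm (polyact t P *m x) <= C * vnorm x.
Proof.
have [C C0 HC] := seminorm_polyact_order (psdmx1 _ _) P 0; exists C => // t x t01.
by rewrite -[C]mulr1 -(expr0 t); apply: HC.
Qed.

Definition exp_poly N : {poly R} := \poly_(k < N) ((-1) ^+ k / k`!%:R).

Lemma expmx_remainder N : exists2 C, 0 <= C & forall t x, 0 <= t <= 1 ->
  vnorm ((expmx (- (t%:C%C *: B)) - polyact t (exp_poly N)) *m x) <=
  C * t ^+ N * vnorm x.
Proof.
exists (n%:R ^+ 2 * (2 * expR (mxsum B))).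
  by rewrite !mulr_ge0 ?exprn_ge0 ?expR_ge0.
move=> t x t01; have t0 : 0 <= t by case/andP: t01.
have -> : n%:R ^+ 2 * (2 * expR (mxsum B)) * t ^+ N * vnorm x =
  n%:R ^+ 2 * (2 * (t ^+ N * expR (mxsum B))) * vnorm x by ring.
apply: vnorm_mulmx_entry_le => i j.
have -> : polyact t (exp_poly N) =
    \sum_(0 <= k < N) (k`!%:R)^-1 *: (- (t%:C%C *: B)) ^+ k.
  rewrite (polyactE _ (size_poly _ _)) big_mkord; apply: eq_bigr => k _.
  rewrite coef_poly ltn_ord -[- (_ *: B)]scaleNr exprZn scalerA; congr (_ *: _).
  rewrite !(rmorphM (real_complex R)) fmorphV (rmorph_nat (real_complex R)).
  rewrite !(rmorphXn (real_complex R)) rmorphN1.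
  by rewrite [in RHS]exprNn mulrAC mulrC mulrA.
apply: le_trans (expmx_entry _ _ _ _) _.
have -> : mxsum (- (t%:C%C *: B)) = t * mxsum B.
  rewrite /mxsum mulr_sumr; apply: eq_bigr => k _; rewrite mulr_sumr.
  apply: eq_bigr => l _; rewrite !mxE -mulNr modulusM.
  by rewrite -(rmorphN (real_complex R)) modulus_real normrN ger0_norm.
apply: ler_wpM2l => //; apply: expR_tail => //; exact: mxsum_ge0.
Qed.

End PolynomialAction.

(** * Expansion of the energy loss *)

Section Energy.
Variables (R : realType) (n' : nat).
Local Notation n := n'.+1.
Variable B : 'M[R[i]]_n.
Hypothesis B_cd : psdmx (hermpart B).
Implicit Types (x y : 'cV[R[i]]_n) (t : R) (k N : nat).
Let I1 : psdmx (1%:M : 'M[R[i]]_n) := psdmx1 _ _.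
Let I1h : (1%:M : 'M[R[i]]_n) \is hermsymmx := proj1 I1.
Let Hh : hermpart B \is hermsymmx := proj1 B_cd.

Lemma hform_hermpart x y :
  2 * hform (hermpart B) x y = hform 1%:M x (B *m y) + hform 1%:M (B *m x) y.
Proof.
rewrite -hform_mulmx -hform_trmx_mulmx mul1mx mulmx1 -hform_addmx /hermpart.
have -> : 2^-1 = (2^-1 : R)%:C%C :> R[i].
  by rewrite fmorphV (rmorph_nat (real_complex R)).
by rewrite hform_scalemx mulVKf.
Qed.

Definition taylor_vec x k : 'cV[R[i]]_n :=
  ((-1) ^+ k / k`!%:R : R)%:C%C *: (B ^+ k *m x).

Lemma taylor_vecS x k : B *m taylor_vec x k = (- k.+1%:R : R)%:C%C *: taylor_vec x k.+1.
Proof.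
rewrite /taylor_vec -scalemxAr mulmxA mulmxE -exprS scalerA; congr (_ *: _).
rewrite -(rmorphM (real_complex R)); congr (_%:C%C).
have n1 : k.+1%:R != 0 :> R by rewrite pnatr_eq0.
have n2 : k`!%:R != 0 :> R by rewrite pnatr_eq0 -lt0n fact_gt0.
rewrite factS natrM exprS.
move: (k.+1%:R) (k`!%:R) n1 n2 => a b n1 n2; by field; rewrite n1 n2.
Qed.

Lemma exp_poly_taylor t x N :
  polyact B t (exp_poly R N) *m x = \sum_(k < N) (t ^+ k)%:C%C *: taylor_vec x k.
Proof.
rewrite (polyact_mulE _ _ _ (size_poly _ _)); apply: eq_bigr => k _.
by rewrite coef_poly ltn_ord /taylor_vec scalerA -(rmorphM (real_complex R)) mulrC.
Qed.

(** At [t B] it gives the [k]-th Legendre coefficient of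
    [s |-> exp(- s t B) x] on [0, 1], computed from the Taylor polynomial of
    degree less than [N]. *)
Definition legendre_coef N k : {poly R} :=
  \poly_(i < N) (legendre_moment R k i * ((-1) ^+ i / i`!%:R)).

Lemma legendre_coef_taylor t x N k : polyact B t (legendre_coef N k) *m x =
  \sum_(i < N) (legendre_moment R k i * t ^+ i)%:C%C *: taylor_vec x i.
Proof.
rewrite (polyact_mulE _ _ _ (size_poly _ _)); apply: eq_bigr => i _.
rewrite coef_poly ltn_ord /taylor_vec scalerA -(rmorphM (real_complex R)).
by rewrite mulrAC.
Qed.

(** By [dissipationE], twice the integral over [0, t] of the form of
    [hermpart B] along the truncated trajectory; the present shape shows that
    each Legendre coefficient contributes a nonnegative amount. *)
Definition dissipation t x N : R := 2 * t * \sum_(k < N) (2 * k + 1)%:R *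
  seminorm (hermpart B) (polyact B t (legendre_coef N k) *m x) ^+ 2.

Lemma hform_double_sum H (c : nat -> R) (v : nat -> 'cV[R[i]]_n) N :
  H \is hermsymmx ->
  hform H (\sum_(i < N) (c i)%:C%C *: v i) (\sum_(i < N) (c i)%:C%C *: v i) =
  \sum_(i < N) \sum_(j < N) c i * c j * hform H (v i) (v j).
Proof.
move=> H_herm; rewrite hform_suml; apply: eq_bigr => i _.
rewrite (hform_sumr H_herm); apply: eq_bigr => j _.
by rewrite hformZl (hformZr H_herm) mulrA.
Qed.

Lemma dissipationE t x N : dissipation t x N =
  \sum_(i < N) \sum_(j < N) 2 * t ^+ (i + j + 1) / (i + j + 1)%:R *
    hform (hermpart B) (taylor_vec x i) (taylor_vec x j).
Proof.
rewrite /dissipation.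
under eq_bigr => k _ do rewrite (sqr_seminorm B_cd) legendre_coef_taylor
  (hform_double_sum (fun i => legendre_moment R k i * t ^+ i)) // mulr_sumr.
rewrite exchange_big mulr_sumr; apply: eq_bigr => i _.
under eq_bigr do rewrite mulr_sumr.
rewrite exchange_big mulr_sumr; apply: eq_bigr => j _.
rewrite -(hilbert_cholesky R j (ltn_ord i)) !mulr_sumr mulr_suml.
by apply: eq_bigr => k _; rewrite !exprD expr1; ring.
Qed.

Lemma vnorm_mulmx_sub (E P : 'M[R[i]]_n) (c d e : R) x :
  vnorm (E *m x) <= c -> vnorm (P *m x) <= d -> vnorm ((E - P) *m x) <= e ->
  `|vnorm (E *m x) ^+ 2 - vnorm (P *m x) ^+ 2| <= e * (c + d).
Proof.
rewrite mulmxBl => Ec Pd EP.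
rewrite subr_sqr normrM; apply: ler_pM => //; last first.
  by rewrite ger0_norm ?addr_ge0 ?seminorm_ge0 // lerD.
apply: le_trans EP; rewrite ler_norml; apply/andP; split; last exact: ler_seminormB.
rewrite lerNl opprB -(seminormN I1 (_ - _)) opprB; exact: ler_seminormB.
Qed.

Lemma taylor_vec_bounded k : exists2 C, 0 <= C &
  forall x, vnorm (taylor_vec x k) <= C * vnorm x.
Proof.
have [C C0 HC] := mulmx_bounded (B ^+ k).
exists (`|(-1) ^+ k / k`!%:R| * C) => [|x]; first exact: mulr_ge0.
rewrite /taylor_vec (seminormZr I1) -mulrA ler_wpM2l //.
Qed.

Lemma taylor_form_bounded i j : exists2 C, 0 <= C &
  forall x, `|hform 1%:M (taylor_vec x i) (taylor_vec x j)| <= C * vnorm x ^+ 2.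
Proof.
have [C C0 HC] := taylor_vec_bounded i; have [D D0 HD] := taylor_vec_bounded j.
exists (C * D) => [|x]; first exact: mulr_ge0.
apply: le_trans (hform_le_seminorm I1 _ _) _.
rewrite expr2 mulrACA; apply: ler_pM => //; exact: vnorm_ge0.
Qed.

Lemma exp_poly_energy N : (0 < N)%N -> exists2 C, 0 <= C &
  forall t x, 0 <= t <= 1 ->
  `|vnorm x ^+ 2 - vnorm (polyact B t (exp_poly R N.+1) *m x) ^+ 2
    - dissipation t x N| <= C * t ^+ N.+1 * vnorm x ^+ 2.
Proof.
move=> N_gt0.
have /choice[C HC] : forall i, exists C, 0 <= C /\ forall x,
    `|hform 1%:M (taylor_vec x i) (taylor_vec x N)| <= C * vnorm x ^+ 2.
  by move=> i; have [C C0 HC] := taylor_form_bounded i N; exists C.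
have C_ge0 i : 0 <= C i by have [] := HC i.
exists (\sum_(i < N) C i *+ 2 + C N).
  by apply: addr_ge0 => //; apply: sumr_ge0 => i _; rewrite mulrn_wge0.
move=> t x /andP[t0 t1].
pose g i j := hform 1%:M (taylor_vec x i) (taylor_vec x j).
have gC i : `|g i N| <= C i * vnorm x ^+ 2 by have [_] := HC i; exact.
pose h i j := hform (hermpart B) (taylor_vec x i) (taylor_vec x j).
have gh i j : 2 * h i j = - (j.+1%:R * g i j.+1) - i.+1%:R * g i.+1 j.
  rewrite hform_hermpart !taylor_vecS (hformZr I1h) hformZl.
  by rewrite -/(g i j.+1) -/(g i.+1 j) !mulNr.
have gE : \sum_(i < N.+1) \sum_(j < N.+1) t ^+ (i + j) * g i j =
    vnorm (polyact B t (exp_poly R N.+1) *m x) ^+ 2.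
  rewrite (sqr_seminorm I1) exp_poly_taylor.
  rewrite (hform_double_sum (fun i => t ^+ i)) //.
  by apply: eq_bigr => i _; apply: eq_bigr => j _; rewrite exprD.
have g00 : g 0%N 0%N = vnorm x ^+ 2.
  rewrite (sqr_seminorm I1) /g /taylor_vec fact0 divr1 !expr0.
  by rewrite (rmorph1 (real_complex R)) scale1r mul1mx.
rewrite -gE.
rewrite (energy_sum t N_gt0 gh).
rewrite g00.
rewrite -dissipationE.
move: (dissipation t x N) => D.
set s := \sum_(i < N) _ * (_ + _); set r := t ^+ (N + N) * _.
have -> : vnorm x ^+ 2 - (vnorm x ^+ 2 - D + s + r) - D = - (s + r) by ring.
rewrite normrN; apply: le_trans (ler_normD _ _) _.
rewrite !mulrDl; apply: lerD.
  rewrite !mulr_suml; apply: le_trans (ler_norm_sum _ _ _) _.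
  apply: ler_sum => i _; rewrite /g (hform_sym I1h (taylor_vec x N)) -/(g i N).
  have -> : C i *+ 2 * t ^+ N.+1 * vnorm x ^+ 2 =
    t ^+ N.+1 * (C i * vnorm x ^+ 2 + C i * vnorm x ^+ 2) by ring.
  rewrite normrM; apply: ler_pM => //; last first.
    by apply: le_trans (ler_normD _ _) _; apply: lerD.
  case: i => [[|i] iN] /=; first by rewrite mul0r mul0r normr0 exprn_ge0.
  rewrite ger0_norm; last by rewrite mulr_ge0 ?exprn_ge0.
  rewrite -[leRHS]mul1r; apply: ler_pM; rewrite ?exprn_ge0 //.
    by rewrite ler_pdivrMr ?ltr0n ?addn_gt0 // mul1r ler_nat leq_addr.
  by apply: ler_wiXn2l => //; rewrite addSn ltnS leq_addl.
have -> : C N * t ^+ N.+1 * vnorm x ^+ 2 = t ^+ N.+1 * (C N * vnorm x ^+ 2) by ring.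
rewrite /r normrM ger0_norm ?exprn_ge0 //; apply: ler_pM => //.
  exact: exprn_ge0.
by apply: ler_wiXn2l => //; rewrite -addn1 leq_add2l.
Qed.

(** Taylor terms of degree less than [N] are enough for the dissipation: after
    integration, a term of degree [N] or more carries at least [N.+1] factors
    [t]. *)
Theorem energy_expansion N : (0 < N)%N -> exists2 C, 0 <= C &
  forall t x, 0 <= t <= 1 ->
  `|vnorm x ^+ 2 - vnorm (expmx (- (t%:C%C *: B)) *m x) ^+ 2
    - dissipation t x N| <= C * t ^+ N.+1 * vnorm x ^+ 2.
Proof.
move=> N_gt0; have [C C0 HC] := exp_poly_energy N_gt0.
have [D D0 HD] := expmx_remainder B N.+1.
have [K K0 HK] := vnorm_polyact_bounded B (exp_poly R N.+1).
exists (C + D * (D + K + K)) => [|t x t01].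
  by rewrite addr_ge0 // mulr_ge0 // !addr_ge0.
have /andP[t0 t1] := t01; have x0 := vnorm_ge0 x.
set E := expmx _ ; set P := polyact B t (exp_poly R N.+1).
have Px : vnorm (P *m x) <= K * vnorm x by apply: HK.
have EPx : vnorm ((E - P) *m x) <= D * t ^+ N.+1 * vnorm x by apply: HD.
have Ex : vnorm (E *m x) <= (D + K) * vnorm x.
  rewrite -[E](subrK P) mulmxDl.
  apply: le_trans (seminormD I1 _ _) _; rewrite mulrDl lerD //.
  apply: le_trans EPx _; rewrite ler_wpM2r // -[leRHS]mulr1 ler_wpM2l //.
  exact: exprn_ile1.
have -> : (C + D * (D + K + K)) * t ^+ N.+1 * vnorm x ^+ 2 =
  C * t ^+ N.+1 * vnorm x ^+ 2 +
  D * t ^+ N.+1 * vnorm x * ((D + K) * vnorm x + K * vnorm x) by ring.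
have triangle (a b c d u v : R) : `|a - b - d| <= u -> `|c - b| <= v ->
    `|a - c - d| <= u + v.
  by rewrite !ler_norml => /andP[? ?] /andP[? ?]; apply/andP; split; lra.
exact: triangle (HC t x t01) (vnorm_mulmx_sub Ex Px EPx).
Qed.

End Energy.

(** * Sums of semidefinite forms and their kernels *)

Section GramSums.
Variables (R : realType) (n : nat).
Implicit Types (H T A : 'M[R[i]]_n) (x y : 'cV[R[i]]_n).

Lemma trmxC_exp A j : (A ^+ j)^t* = A^t* ^+ j.
Proof.
elim: j => [|j IH]; first by rewrite !expr0 trmx1 map_mx1.
rewrite exprS exprSr -IH -[A * _]/(A *m _) -[_ * A^t*]/(_ *m A^t*).
by rewrite trmx_mul map_mxM.
Qed.

(** The common shape of the matrices that define the hypocoercivity index, with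
    [G j] the [j]-th power of a matrix. *)
Definition gram_sum H (G : nat -> 'M[R[i]]_n) N : 'M[R[i]]_n :=
  \sum_(0 <= j < N) (G j)^t* *m H *m G j.

Section Psd.
Variables (H : 'M[R[i]]_n) (G : nat -> 'M[R[i]]_n).
Hypothesis H_psd : psdmx H.

Lemma gram_sum_herm N : gram_sum H G N \is hermsymmx.
Proof.
have [/hermsymmxP Hh _] := H_psd.
apply/hermsymmxP; rewrite /gram_sum raddf_sum raddf_sum; apply: eq_bigr => j _ /=.
by rewrite !trmx_mul !map_mxM Hh trmxCK mulmxA.
Qed.

Lemma hform_gram_sum N x :
  hform (gram_sum H G N) x x = \sum_(0 <= j < N) seminorm H (G j *m x) ^+ 2.
Proof.
rewrite /gram_sum; elim: N => [|N IH].
  by rewrite !big_nil -(scale0r 1%:M) -(rmorph0 (real_complex R)) hform_scalemx mul0r.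
rewrite !big_nat_recr //= hform_addmx IH; congr (_ + _).
by rewrite hform_mulmx hform_trmx_mulmx sqr_seminorm.
Qed.

Lemma gram_sum_psd N : psdmx (gram_sum H G N).
Proof.
split=> [|x]; first exact: gram_sum_herm.
rewrite innerp_hform ?gram_sum_herm // ler0c hform_gram_sum.
by apply: sumr_ge0 => j _; exact: sqr_ge0.
Qed.

Lemma gram_sum_ker N x : gram_sum H G N *m x = 0 <->
  forall j, (j < N)%N -> seminorm H (G j *m x) = 0.
Proof.
have fE : gram_sum H G N *m x = 0 <-> hform (gram_sum H G N) x x = 0.
  split=> [/(ker_seminorm)|h0].
    by rewrite -(sqr_seminorm (gram_sum_psd N)) => ->; rewrite expr0n.
  by apply: (seminorm_eq0 (gram_sum_psd N)); rewrite seminorm.unlock h0 sqrtr0.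
rewrite fE hform_gram_sum; split=> [/eqP|h0].
  rewrite big_mkord psumr_eq0 => [/allP h j jN|j _]; last exact: sqr_ge0.
  have := h (Ordinal jN) (mem_index_enum _); rewrite sqrf_eq0; exact: eqP.
by rewrite big_mkord big1 // => j _; rewrite h0 ?ltn_ord // expr0n.
Qed.

Lemma gram_sum_posdef N : posdefmx (gram_sum H G N) <->
  forall x, (forall j, (j < N)%N -> seminorm H (G j *m x) = 0) -> x = 0.
Proof.
split=> [[_ pos] x /gram_sum_ker kx|h].
  have [//|/pos] := eqVneq x 0.
  rewrite kx innerpE big1 ?ltxx // => i _; by rewrite mxE conjC0 mulr0.
split=> [|x x0]; first exact: gram_sum_herm.
have [_ /(_ x)] := gram_sum_psd N; rewrite le_eqVlt => /orP[/eqP e|//].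
case/eqP: x0; apply/h/gram_sum_ker; apply: (seminorm_eq0 (gram_sum_psd N)).
by rewrite seminorm.unlock hform.unlock -e /= sqrtr0.
Qed.

End Psd.

Lemma innerp_gram H (G : 'M[R[i]]_n) x : psdmx H ->
  innerp x ((G^t* *m H *m G) *m x) = (seminorm H (G *m x) ^+ 2)%:C%C.
Proof.
move=> H_psd; rewrite (sqr_seminorm H_psd) -(innerp_hform (proj1 H_psd)).
by rewrite -!mulmxA (innerp_adj (G^t*)) trmxCK.
Qed.

(** The distance to the kernel is controlled by the seminorm itself: if
    [T Z T = T], then [x - Z T x] is in the kernel of [T], and
    [|T x|^2 = <T x, T x>] is bounded by the Cauchy-Schwarz inequality for the
    form of [T]. *)
Lemma near_kernel T : psdmx T -> exists2 C, 0 <= C & forall x, exists x0,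
  T *m x0 = 0 /\ vnorm (x - x0) <= C * seminorm T x.
Proof.
move=> T_psd.
have [Z TZT] : exists Z, T *m Z *m T = T.
  by exists (pinvmx T); exact: (mulmxKpV (submx_refl T)).
have [C C0 HC] := mulmx_bounded Z; have [D D0 HD] := seminorm_bounded T_psd.
exists (C * D) => [|x]; first exact: mulr_ge0.
exists (x - Z *m (T *m x)); split.
  by rewrite mulmxBr !mulmxA TZT subrr.
rewrite opprB addrC subrK; apply: le_trans (HC _) _; rewrite -mulrA ler_wpM2l //.
have [->|Tx0] := eqVneq (vnorm (T *m x)) 0.
  by rewrite mulr_ge0 ?seminorm_ge0.
have Tx_gt0 : 0 < vnorm (T *m x) by rewrite lt0r Tx0 seminorm_ge0.
rewrite -(ler_pM2l Tx_gt0) -expr2 (sqr_seminorm (psdmx1 _ _)) -hform_mulmx mul1mx.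
apply: le_trans (ler_norm _) _; apply: le_trans (hform_le_seminorm T_psd _ _) _.
by rewrite mulrA [_ * D]mulrC ler_wpM2r ?seminorm_ge0.
Qed.

End GramSums.

(** * A polynomial dual to the Legendre coefficients *)

Section LegendrePoly.
Variable R : realType.
Implicit Types (k m N : nat).

Lemma legendre_coef_lt N k i : (i < k)%N -> (legendre_coef R N k)`_i = 0.
Proof.
by move=> ik; rewrite coef_poly legendre_moment_lt // mul0r if_same.
Qed.

Lemma legendre_coef_diag N k : (k < N)%N ->
  (legendre_coef R N k)`_k = (-1) ^+ k * (k`!%:R / (2 * k + 1)`!%:R).
Proof.
move=> kN; rewrite coef_poly kN legendre_moment_diag.
have n1 : k`!%:R != 0 :> R by rewrite pnatr_eq0 -lt0n fact_gt0.
have n2 : (2 * k + 1)`!%:R != 0 :> R by rewrite pnatr_eq0 -lt0n fact_gt0.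
move: (k`!%:R) ((2 * k + 1)`!%:R) ((-1) ^+ k) n1 n2 => a b c n1 n2.
by field; rewrite n1 n2.
Qed.

Lemma legendre_coef_diag_neq0 N k : (k < N)%N -> (legendre_coef R N k)`_k != 0.
Proof.
move=> kN; rewrite legendre_coef_diag //.
by rewrite !mulf_neq0 ?signr_eq0 ?invr_eq0 ?pnatr_eq0 -?lt0n ?fact_gt0.
Qed.

(** The coefficient of degree [m] of [legendre_coef R N k * A] involves the
    coefficients of [A] up to degree [m - k] only, and the last one with the
    nonzero factor [(legendre_coef R N k)`_k].  So the conditions for
    [k = m - 1, m - 2, ...] can be met one after the other, each by choosing one
    more coefficient of [A]. *)
Lemma legendre_dual_poly m N : (m < N)%N -> exists2 A : {poly R}, A`_0 = 1 &
  forall k, (legendre_coef R N k * A)`_m =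
    if k == m then (legendre_coef R N m)`_m else 0.
Proof.
move=> mN.
have [A A0 HA] : exists2 A : {poly R}, A`_0 = 1 & forall k, (k < m)%N ->
    (legendre_coef R N k * A)`_m = 0.
  suff /(_ m (leqnn m)) : forall l, (l <= m)%N -> exists2 A : {poly R}, A`_0 = 1 &
      forall k, (m - l <= k < m)%N -> (legendre_coef R N k * A)`_m = 0.
    by case=> A A0 HA; exists A => // k km; apply: HA; rewrite subnn.
  elim=> [_|l IH lm].
    exists 1 => [|k]; first by rewrite coef1.
    by rewrite subn0 => /andP[/leq_ltn_trans /[apply]]; rewrite ltnn.
  have [A A0 HA] := IH (ltnW lm).
  pose k0 := (m - l.+1)%N; pose L := legendre_coef R N k0.
  have L0 : L`_k0 != 0.
    by apply: legendre_coef_diag_neq0; rewrite /k0 ltn_subLR //; lia.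
  exists (A - ((L * A)`_m / L`_k0) *: 'X^(l.+1)) => [|k /andP[kl km]].
    by rewrite coefB coefZ coefXn A0 mulr0 subr0.
  rewrite mulrBr coefB -scalerAr coefZ coefMXn ltnNge lm /= -/k0.
  have [e|ne] := eqVneq k k0; first by rewrite e -/L divfK // subrr.
  have k0k : (k0 < k)%N by rewrite ltn_neqAle eq_sym ne.
  have mlk : (m - l <= k < m)%N by rewrite km andbT; move: k0k; rewrite /k0; lia.
  by rewrite HA // (legendre_coef_lt _ k0k) mulr0 subr0.
exists A => // k; case: eqP => [->|/eqP km].
  rewrite coefM (bigD1 ord_max) //= subnn A0 mulr1 big1 ?addr0 // => i im.
  by rewrite legendre_coef_lt ?mul0r // ltn_neqAle im -ltnS ltn_ord.
have [|mk] := ltnP k m; first exact: HA.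
rewrite coefM big1 // => i _; rewrite legendre_coef_lt ?mul0r //.
by have := ltn_ord i; lia.
Qed.

End LegendrePoly.

(** * The operator norm *)

Section OperatorNorm.
Variables (R : realType) (n' : nat).
Local Notation n := n'.+1.
Implicit Types (A : 'M[R[i]]_n) (x : 'cV[R[i]]_n).

Lemma vnorm_mulmx_le_opnorm2 A x : vnorm x = 1 -> vnorm (A *m x) <= opnorm2 A.
Proof.
move=> x1; apply: ub_le_sup; last first.
  by exists x; rewrite /= norm2_seminorm.
have [C C0 HC] := mulmx_bounded A; exists C => _ [y /= y1 <-].
by have := HC y; rewrite -!norm2_seminorm y1 mulr1.
Qed.

Lemma opnorm2_le A b : (forall x, vnorm x = 1 -> vnorm (A *m x) <= b) ->
  opnorm2 A <= b.
Proof.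
move=> Ab; apply: ge_sup.
  exists (norm2 (A *m delta_mx 0 0)), (delta_mx 0 0) => //=.
  by rewrite norm2_seminorm vnorm_delta.
by move=> _ [x /= x1 <-]; rewrite norm2_seminorm; apply: Ab; rewrite -norm2_seminorm.
Qed.

Lemma opnorm2_ge0 A : 0 <= opnorm2 A.
Proof.
apply: le_trans (vnorm_mulmx_le_opnorm2 A (vnorm_delta R (0 : 'I_n))).
exact: seminorm_ge0.
Qed.

Lemma vnorm_eq0 x : vnorm x = 0 -> x = 0.
Proof. by move/(seminorm_eq0 (psdmx1 _ _)); rewrite mul1mx. Qed.

Lemma vnorm_normalize x : vnorm x != 0 ->
  vnorm ((vnorm x)^-1%:C%C *: x) = 1.
Proof.
move=> x0; rewrite (seminormZr (psdmx1 _ _)) ger0_norm ?invr_ge0 ?seminorm_ge0 //.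
exact: mulVf.
Qed.

Lemma vnorm_mulmx_le A x : vnorm (A *m x) <= opnorm2 A * vnorm x.
Proof.
have [x0|x0] := eqVneq (vnorm x) 0.
  by rewrite (vnorm_eq0 x0) mulmx0 seminorm0 mulr0.
rewrite -ler_pdivrMr ?lt0r ?x0 ?seminorm_ge0 //.
apply: le_trans (vnorm_mulmx_le_opnorm2 A (vnorm_normalize x0)).
rewrite -scalemxAr (seminormZr (psdmx1 _ _)) mulrC.
by rewrite ger0_norm ?invr_ge0 ?seminorm_ge0.
Qed.

End OperatorNorm.

(** * Two-sided bounds for the decay *)

Section ShortTime.
Variables (R : realType) (n' : nat).
Local Notation n := n'.+1.
Variable B : 'M[R[i]]_n.
Hypothesis B_cd : psdmx (hermpart B).
Implicit Types (x y : 'cV[R[i]]_n) (t : R) (k m N : nat).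
Local Notation p := (seminorm (hermpart B)).
Local Notation flow t := (expmx (- (t%:C%C *: B))).

(** The form of [hermpart B] detects neither [x] nor its first derivatives along
    the flow, up to order [m - 1].  This is the kernel of [hc_Ttilde2 B m.-1] when
    [m] is positive, and everything when [m = 0]. *)
Definition silent m x := forall j, (j < m)%N -> p (B ^+ j *m x) = 0.

Definition lead_moment k : R := k`!%:R / (2 * k + 1)`!%:R.

Lemma lead_moment_gt0 k : 0 < lead_moment k.
Proof. by rewrite divr_gt0 // ltr0n fact_gt0. Qed.

Lemma legendre_coef_lead N k : (k < N)%N ->
  `|(legendre_coef R N k)`_k| = lead_moment k.
Proof.
move=> kN; rewrite legendre_coef_diag // normrM normrX normrN1 expr1n mul1r.
by rewrite ger0_norm // ltW // lead_moment_gt0.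
Qed.

(** The constant [c] of the expansion, when [s] is the minimum of
    [p (B ^+ m *m x)] over the silent unit vectors [x]. *)
Definition decay_rate m s : R := (2 * m + 1)%:R * lead_moment m ^+ 2 * s ^+ 2.

Lemma near_silent m : exists2 C, 0 <= C & forall x e, 0 <= e ->
  (forall k, (k < m)%N -> p (B ^+ k *m x) <= e) ->
  exists x0, silent m x0 /\ vnorm (x - x0) <= C * e.
Proof.
have [C C0 HC] := near_kernel (gram_sum_psd (fun j => B ^+ j) B_cd m).
exists (C * m%:R) => [|x e e0 small]; first exact: mulr_ge0.
have [x0 [kx0 le_x0]] := HC x; exists x0; split.
  by move=> j jm; move/(gram_sum_ker (fun j => B ^+ j) B_cd): kx0 => /(_ _ jm).
apply: le_trans le_x0 _; rewrite -mulrA ler_wpM2l //.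
apply: seminorm_le; first exact: mulr_ge0.
rewrite hform_gram_sum // big_mkord.
apply: le_trans (_ : \sum_(j < m) e ^+ 2 <= _).
  by apply: ler_sum => j _; rewrite ler_sqr ?nnegrE ?seminorm_ge0 // small.
rewrite sumr_const card_ord -[leLHS]mulr_natl exprMn ler_wpM2r ?sqr_ge0 //.
by rewrite -natrX ler_nat; case: (m) => // k; rewrite expnS leq_pmulr.
Qed.

Lemma dissipation_ge t x N k : 0 <= t -> (k < N)%N ->
  2 * t * ((2 * k + 1)%:R * p (polyact B t (legendre_coef R N k) *m x) ^+ 2)
    <= dissipation B t x N.
Proof.
move=> t0 kN; rewrite /dissipation ler_wpM2l ?mulr_ge0 //.
rewrite (bigD1 (Ordinal kN)) //= lerDl; apply: sumr_ge0 => j _.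
by rewrite mulr_ge0 ?sqr_ge0.
Qed.

Lemma legendre_seminorm N k : exists2 C, 0 <= C & forall t x, 0 <= t <= 1 ->
  (k < N)%N ->
  `|p (polyact B t (legendre_coef R N k) *m x) -
    lead_moment k * t ^+ k * p (B ^+ k *m x)| <= C * t ^+ k.+1 * vnorm x.
Proof.
have [C C0 HC] := seminorm_polyact_lead B B_cd (legendre_coef R N k) k.
exists C => // t x t01 kN; rewrite -(legendre_coef_lead kN); apply: HC => // i ik.
by left; exact: legendre_coef_lt.
Qed.

(** If the loss is only of order [t ^+ (2 * m + 1)], the [k]-th Legendre term
    forces [t ^+ k * p (B ^+ k *m x)] to be of order [t ^+ m] up to an error of
    order [t ^+ k.+1]; for [k < m] the error dominates, and a factor [t] is
    left. *)
Lemma small_observations m (K : R) : 0 <= K -> exists2 F, 0 <= F & forall t x k,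
  0 < t <= 1 -> vnorm x = 1 -> (k < m)%N ->
  dissipation B t x (2 * m + 1) <= K * t ^+ (2 * m + 1) ->
  p (B ^+ k *m x) <= F * t.
Proof.
move=> K0; set N := (2 * m + 1)%N.
have /choice[C HC] : forall k, exists C, 0 <= C /\ forall t x, 0 <= t <= 1 ->
  (k < N)%N -> `|p (polyact B t (legendre_coef R N k) *m x) -
    lead_moment k * t ^+ k * p (B ^+ k *m x)| <= C * t ^+ k.+1 * vnorm x.
  by move=> k; have [C C0 HC] := legendre_seminorm N k; exists C.
have C_ge0 k : 0 <= C k by have [] := HC k.
exists (\sum_(k < m) (K + 1 + C k) / lead_moment k).
  apply: sumr_ge0 => k _; rewrite divr_ge0 ?(ltW (lead_moment_gt0 _)) //.
  by rewrite !addr_ge0.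
move=> t x k /andP[t0 t1] x1 km dis.
have kN : (k < N)%N by rewrite /N; lia.
have t01 : 0 <= t <= 1 by rewrite (ltW t0).
set w := p (polyact B t (legendre_coef R N k) *m x).
have w_ge0 : 0 <= w by exact: seminorm_ge0.
have w2 : w ^+ 2 <= K * t ^+ (m + m).
  have := le_trans (dissipation_ge x (ltW t0) kN) dis; rewrite -/w.
  have -> : K * t ^+ N = t * (K * t ^+ (m + m)).
    by rewrite /N addn1 exprS mul2n addnn; ring.
  have -> : 2 * t * ((2 * k + 1)%:R * w ^+ 2) = t * (2 * (2 * k + 1)%:R * w ^+ 2) by ring.
  rewrite ler_pM2l //; apply: le_trans; rewrite -[leLHS]mul1r ler_wpM2r ?sqr_ge0 //.
  by rewrite -natrM ler1n; lia.
have w_le : w <= (K + 1) * t ^+ k.+1.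
  apply: le_trans (_ : (K + 1) * t ^+ m <= _); last first.
    by rewrite ler_wpM2l ?addr_ge0 // ler_wiXn2l // ltW.
  rewrite -ler_sqr ?nnegrE ?mulr_ge0 ?addr_ge0 ?exprn_ge0 // ?(ltW t0) //.
  apply: le_trans w2 _; rewrite exprMn -exprM muln2 addnn ler_wpM2r //.
    by rewrite exprn_ge0 // ltW.
  by nra.
have [_ /(_ t x t01 kN)] := HC k; rewrite x1 mulr1 -/w.
move=> /ler_normlP[]; rewrite opprB lerBlDr => h _.
have : t ^+ k * (lead_moment k * p (B ^+ k *m x)) <= t ^+ k * ((K + 1 + C k) * t).
  apply: le_trans (_ : C k * t ^+ k.+1 + w <= _); first by rewrite mulrCA mulrA.
  have -> : t ^+ k * ((K + 1 + C k) * t) = C k * t ^+ k.+1 + (K + 1) * t ^+ k.+1.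
    by rewrite exprS; ring.
  by rewrite lerD2l.
rewrite ler_pM2l ?exprn_gt0 // mulrC -ler_pdivlMr ?lead_moment_gt0 //.
move=> /le_trans; apply; rewrite mulrAC ler_wpM2r ?(ltW t0) //.
rewrite (bigD1 (Ordinal km)) //= lerDl; apply: sumr_ge0 => j _.
by rewrite divr_ge0 ?(ltW (lead_moment_gt0 _)) // !addr_ge0.
Qed.

(** A vector that loses more than the claimed amount satisfies the bound.  Any
    other vector is close to a silent one by [small_observations] and
    [near_silent], and for silent vectors the hypothesis bounds the Legendre term
    [k = m] from below. *)
Lemma flow_upper_bound m s : 0 <= s ->
  (forall x, silent m x -> s * vnorm x <= p (B ^+ m *m x)) ->
  exists2 M, 0 <= M & forall t x, 0 <= t <= 1 -> vnorm x = 1 ->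
  vnorm (flow t *m x) ^+ 2 <=
    1 - 2 * decay_rate m s * t ^+ (2 * m + 1) + M * t ^+ (2 * m + 2).
Proof.
move=> s0 Hs; set N := (2 * m + 1)%N; set c := decay_rate m s.
have c0 : 0 <= c.
  by rewrite /c /decay_rate !mulr_ge0 ?sqr_ge0 // ltW // exprn_gt0 // lead_moment_gt0.
have N0 : (0 < N)%N by rewrite /N addn1.
have mN : (m < N)%N by rewrite /N addn1 ltnS leq_pmull.
have [C C0 HC] := energy_expansion B_cd N0.
have K0 : 0 <= 2 * c + C by rewrite addr_ge0 // mulr_ge0.
have [F F0 HF] := small_observations m K0.
have [G G0 HG] := near_silent m.
have [L L0 HL] := seminorm_mulmx_bounded B_cd (B ^+ m).
have [D D0 HD] := legendre_seminorm N m.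
pose b := lead_moment m; have b0 : 0 < b := lead_moment_gt0 m.
pose Y := b * ((s + L) * (G * F)) + D.
have Y0 : 0 <= Y.
  by rewrite /Y addr_ge0 // mulr_ge0 ?(ltW b0) // mulr_ge0 ?addr_ge0 // mulr_ge0.
exists (2 * (2 * m + 1)%:R * (2 * (b * s) * Y) + C) => [|t x /andP[t0 t1] x1].
  by rewrite addr_ge0 // !mulr_ge0 // ltW.
have t01 : 0 <= t <= 1 by rewrite t0.
have NE : N.+1 = (2 * m + 2)%N by rewrite /N addn1 addn2.
have := HC t x t01; rewrite x1 expr1n mulr1 NE.
set e := vnorm (flow t *m x) ^+ 2; set d := dissipation B t x N.
move=> /ler_normlP[h1 h2].
have [t_eq0|tn0] := eqVneq t 0.
  move: h1 h2; rewrite /d /dissipation t_eq0 !expr0n /N addn1 addn2 !mulr0 mul0r.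
  by rewrite addr0 subr0; lra.
have t_gt0 : 0 < t by rewrite lt0r tn0.
have [//|big] := lerP e (1 - 2 * c * t ^+ N).
  move=> /le_trans; apply; rewrite lerDl mulr_ge0 ?exprn_ge0 //.
  by rewrite addr_ge0 // !mulr_ge0 // ltW.
have tN : t ^+ (2 * m + 2) <= t ^+ N by rewrite ler_wiXn2l // /N leq_add2l.
have d_le : d <= (2 * c + C) * t ^+ N.
  have : C * t ^+ (2 * m + 2) <= C * t ^+ N by rewrite ler_wpM2l.
  by move: big h1 h2; rewrite mulrDl; lra.
have small k : (k < m)%N -> p (B ^+ k *m x) <= F * t.
  by move=> km; apply: HF => //; rewrite t_gt0.
have [x0 [x0_silent x0_near]] := HG x (F * t) (mulr_ge0 F0 t0) small.
have pm : s - (s + L) * (G * F) * t <= p (B ^+ m *m x).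
  have h3 : s * vnorm x0 <= p (B ^+ m *m x0) := Hs _ x0_silent.
  have h4 : p (B ^+ m *m x0) - p (B ^+ m *m x) <= L * vnorm (x - x0).
    apply: le_trans (HL _); rewrite mulmxBr.
    apply: le_trans (ler_seminormB B_cd _ _) _.
    by rewrite -(seminormN B_cd) opprB.
  have h5 : 1 - vnorm x0 <= vnorm (x - x0).
    by rewrite -x1; exact: ler_seminormB (psdmx1 _ _) _ _.
  have h6 : s * (1 - vnorm x0) <= s * vnorm (x - x0) by rewrite ler_wpM2l.
  have h7 : (s + L) * vnorm (x - x0) <= (s + L) * (G * (F * t)).
    by rewrite ler_wpM2l // addr_ge0.
  have -> : (s + L) * (G * F) * t = (s + L) * (G * (F * t)) by ring.
  by rewrite mulrBr mulr1 in h6; rewrite mulrDl in h7; lra.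
have wm : t ^+ m * (b * s - Y * t) <=
    p (polyact B t (legendre_coef R N m) *m x).
  have := HD t x t01 mN; rewrite x1 mulr1 -/b => /ler_normlP[h3 _].
  have h4 : b * t ^+ m * (s - (s + L) * (G * F) * t) <= b * t ^+ m * p (B ^+ m *m x).
    by rewrite ler_wpM2l // mulr_ge0 ?exprn_ge0 // ltW.
  have -> : t ^+ m * (b * s - Y * t) =
    b * t ^+ m * (s - (s + L) * (G * F) * t) - D * t ^+ m.+1 by rewrite /Y exprS; ring.
  by lra.
have w2 : t ^+ (m + m) * ((b * s) ^+ 2 - 2 * (b * s) * (Y * t)) <=
    p (polyact B t (legendre_coef R N m) *m x) ^+ 2.
  have tm0 : 0 <= t ^+ m by rewrite exprn_ge0.
  have bs0 : 0 <= b * s by rewrite mulr_ge0 // ltW.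
  have := @sqr_ge_sub _ (t ^+ m * (b * s)) (t ^+ m * (Y * t)) _
    (mulr_ge0 tm0 bs0) (mulr_ge0 tm0 (mulr_ge0 Y0 t0))
    (seminorm_ge0 (hermpart B) _).
  rewrite -mulrBr => /(_ _ wm); apply: le_trans.
  by rewrite exprD le_eqVlt; apply/orP; left; apply/eqP; ring.
have d_ge : 2 * c * t ^+ N -
    2 * (2 * m + 1)%:R * (2 * (b * s) * Y) * t ^+ (2 * m + 2) <= d.
  apply: le_trans (dissipation_ge x t0 mN).
  have -> : 2 * c * t ^+ N - 2 * (2 * m + 1)%:R * (2 * (b * s) * Y) * t ^+ (2 * m + 2)
    = 2 * t * ((2 * m + 1)%:R * (t ^+ (m + m) * ((b * s) ^+ 2 - 2 * (b * s) * (Y * t)))).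
    rewrite /c /decay_rate -/b /N addn1 addn2 !exprS mul2n addnn.
    by move: ((_).+1%:R) => a; ring.
  by rewrite ler_wpM2l ?mulr_ge0 // ler_wpM2l.
by move: d_ge h1 h2; rewrite mulrDl; lra.
Qed.

(** On a silent vector, [legendre_coef R N k * A] acts to leading order through
    its coefficient of degree [m], and [A] makes that coefficient vanish unless
    [k = m]. *)
Lemma dual_dissipation m s x0 A : 0 <= s -> silent m x0 -> vnorm x0 = 1 ->
  p (B ^+ m *m x0) = s ->
  (forall k, (legendre_coef R (2 * m + 1) k * A)`_m =
    if k == m then (legendre_coef R (2 * m + 1) m)`_m else 0) ->
  exists2 W, 0 <= W & forall t, 0 <= t <= 1 ->
  dissipation B t (polyact B t A *m x0) (2 * m + 1) <=
    2 * decay_rate m s * t ^+ (2 * m + 1) + W * t ^+ (2 * m + 2).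
Proof.
move=> s0 x0_silent x01 x0s HA; set N := (2 * m + 1)%N.
have mN : (m < N)%N by rewrite /N addn1 ltnS leq_pmull.
pose b := lead_moment m; have b0 : 0 <= b := ltW (lead_moment_gt0 m).
pose a k : R := if k == m then b * s else 0.
have a0 k : 0 <= a k by rewrite /a; case: eqP => // _; exact: mulr_ge0.
have /choice[C HC] : forall k, exists C, 0 <= C /\ forall t, 0 <= t <= 1 ->
    p (polyact B t (legendre_coef R N k) *m (polyact B t A *m x0)) <=
    t ^+ m * (a k + C * t).
  move=> k.
  have [C C0 HC] := seminorm_polyact_lead B B_cd (legendre_coef R N k * A) m.
  exists C; split=> // t t01; rewrite polyactM.
  have /ler_normlP[_] := HC t x0 t01 (fun i im => or_intror (x0_silent i im)).
  rewrite HA x01 mulr1 x0s lerBlDr => /le_trans; apply.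
  rewrite /a; case: eqP => _.
    rewrite (legendre_coef_lead mN) exprS le_eqVlt; apply/orP; left; apply/eqP.
    by rewrite /b; ring.
  by rewrite normr0 exprS le_eqVlt; apply/orP; left; apply/eqP; ring.
have C0 k : 0 <= C k by have [] := HC k.
pose W0 k := 2 * a k * C k + C k ^+ 2.
have W00 k : 0 <= W0 k by rewrite addr_ge0 ?sqr_ge0 // !mulr_ge0.
exists (2 * \sum_(k < N) (2 * k + 1)%:R * W0 k).
  by rewrite mulr_ge0 // sumr_ge0 // => k _; rewrite mulr_ge0.
move=> t t01; have /andP[t0 t1] := t01; rewrite /dissipation.
have wk k : p (polyact B t (legendre_coef R N k) *m (polyact B t A *m x0)) ^+ 2
    <= t ^+ (m + m) * (a k ^+ 2 + W0 k * t).
  have tm0 : 0 <= t ^+ m by rewrite exprn_ge0.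
  have act0 : 0 <= a k + C k * t by rewrite addr_ge0 // mulr_ge0.
  have [_ /(_ t t01) h] := HC k.
  apply: le_trans (_ : (t ^+ m * (a k + C k * t)) ^+ 2 <= _).
    by rewrite ler_sqr ?nnegrE ?seminorm_ge0 // mulr_ge0.
  rewrite exprMn -exprM muln2 addnn ler_wpM2l ?exprn_ge0 //.
  exact: sqr_le_add.
apply: le_trans (_ : 2 * t * \sum_(k < N) (2 * k + 1)%:R *
    (t ^+ (m + m) * (a k ^+ 2 + W0 k * t)) <= _).
  rewrite ler_wpM2l ?mulr_ge0 //; apply: ler_sum => k _.
  by rewrite ler_wpM2l.
have -> : \sum_(k < N) (2 * k + 1)%:R * (t ^+ (m + m) * (a k ^+ 2 + W0 k * t)) =
    t ^+ (m + m) * (\sum_(k < N) (2 * k + 1)%:R * a k ^+ 2 +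
      t * \sum_(k < N) (2 * k + 1)%:R * W0 k).
  rewrite !mulr_sumr -big_split mulr_sumr; apply: eq_bigr => k _ /=.
  by move: ((_ + 1)%:R) => c; ring.
have -> : \sum_(k < N) (2 * k + 1)%:R * a k ^+ 2 = decay_rate m s.
  rewrite (bigD1 (Ordinal mN)) //= big1 ?addr0 => [|k].
    by rewrite /a eqxx exprMn mulrA.
  by rewrite -val_eqE /= /a => /negPf ->; rewrite expr0n mulr0.
rewrite le_eqVlt; apply/orP; left; apply/eqP.
rewrite /N addn1 addn2 !exprS mul2n addnn.
by move: (\sum_(k < _) _) => S; ring.
Qed.

(** The vector [polyact B t A *m x0] has norm [1 + O(t)] because [A] has
    constant term 1, and it loses no more than claimed by
    [dual_dissipation]. *)
Lemma flow_lower_bound m s x0 : 0 <= s -> silent m x0 -> vnorm x0 = 1 ->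
  p (B ^+ m *m x0) = s ->
  exists M eps, [/\ 0 <= M, 0 < eps <= 1 & forall t, 0 <= t < eps ->
  1 - 2 * decay_rate m s * t ^+ (2 * m + 1) - M * t ^+ (2 * m + 2) <=
    opnorm2 (flow t) ^+ 2].
Proof.
move=> s0 x0_silent x01 x0s; set N := (2 * m + 1)%N; set c := decay_rate m s.
have N0 : (0 < N)%N by rewrite /N addn1.
have mN : (m < N)%N by rewrite /N addn1 ltnS leq_pmull.
have c0 : 0 <= c.
  by rewrite /c /decay_rate !mulr_ge0 ?sqr_ge0 // ltW // exprn_gt0 // lead_moment_gt0.
have [C C0 HC] := energy_expansion B_cd N0.
have [A A0 HA] := legendre_dual_poly R mN.
have [W W0 HW] := dual_dissipation s0 x0_silent x01 x0s HA.
have [D D0 HD] := seminorm_polyact_lead B (psdmx1 R n) A 0.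
have [W' W'E W'0] : exists2 W', W' = W + C * (1 + D) ^+ 2 & 0 <= W'.
  by eexists; first reflexivity; rewrite addr_ge0 // mulr_ge0 // sqr_ge0.
(* Below [(4 * D + 1)^-1] one has [4 * D * t + t <= 1], as [normalized_gap] needs. *)
exists (W' + 8 * c * D + 4 * D * W'), (4 * D + 1)^-1; split.
- by rewrite !addr_ge0 // !mulr_ge0.
- by rewrite invr_gt0 invf_le1 ?lerDr ?mulr_ge0 ?ltr_wpDl ?mulr_ge0.
move=> t /andP[t0 teps].
have D1 : 0 < 4 * D + 1 by rewrite ltr_wpDl // mulr_ge0.
have Dt : 4 * D * t + t <= 1.
  by have := ltW teps; rewrite -(ler_pM2l D1) mulfV ?gt_eqF // mulrDl mul1r.
have t1 : t <= 1 by apply: le_trans Dt; rewrite lerDr !mulr_ge0.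
have Dt1 : 4 * D * t <= 1 by apply: le_trans Dt; rewrite lerDl.
have t01 : 0 <= t <= 1 by rewrite t0.
set X := polyact B t A *m x0.
have /ler_normlP[X1 X2] : `|vnorm X - 1| <= D * t.
  have := HD t x0 t01 (fun i im => False_ind _ (notF im)).
  by rewrite A0 normr1 !expr0 mul1mx !mul1r x01 expr1 mulr1.
have X_le : vnorm X <= 1 + D.
  by rewrite -lerBlDl (le_trans X2) // ler_piMr.
have gap : (1 - opnorm2 (flow t) ^+ 2) * vnorm X ^+ 2 <=
    2 * c * t ^+ N + W' * t ^+ (2 * m + 2).
  have h1 : vnorm (flow t *m X) ^+ 2 <= opnorm2 (flow t) ^+ 2 * vnorm X ^+ 2.
    rewrite -exprMn ler_sqr ?nnegrE ?mulr_ge0 ?opnorm2_ge0 ?seminorm_ge0 //.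
    exact: vnorm_mulmx_le.
  have /ler_normlP[_ h2] := HC t X t01.
  have h3 := HW t t01.
  have h4 : C * t ^+ N.+1 * vnorm X ^+ 2 <= C * t ^+ N.+1 * (1 + D) ^+ 2.
    rewrite ler_wpM2l ?mulr_ge0 ?exprn_ge0 // ler_sqr ?nnegrE ?seminorm_ge0 //.
    by rewrite addr_ge0.
  have NE : N.+1 = (2 * m + 2)%N by rewrite /N addn1 addn2.
  rewrite NE in h2 h4; rewrite mulrBl mul1r.
  have -> : W' * t ^+ (2 * m + 2) = W * t ^+ (2 * m + 2) +
    C * t ^+ (2 * m + 2) * (1 + D) ^+ 2 by rewrite W'E; ring.
  move: h1 h2 h3 h4; rewrite -/X -/N -/c.
  move: (dissipation _ _ _ _) (vnorm (flow t *m X) ^+ 2) (vnorm X ^+ 2).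
  by move=> *; lra.
have w0 : 0 <= 2 * c * t ^+ N + W' * t ^+ (2 * m + 2).
  by rewrite addr_ge0 ?mulr_ge0 ?exprn_ge0.
have X3 : 1 - D * t <= vnorm X by rewrite lerBlDr -lerBlDl -opprB.
have := normalized_gap D0 t0 Dt1 X3 w0 gap.
rewrite lerBlDr addrC -lerBlDr => /(le_trans _); apply.
rewrite -addrA -opprD lerD2l lerN2.
have tN : t ^+ (2 * m + 2) = t ^+ N * t by rewrite /N addn1 addn2 exprSr.
have tN2 : W' * D * (t ^+ N * t) * t <= W' * D * (t ^+ N * t).
  by rewrite ler_piMr // !mulr_ge0 // exprn_ge0.
rewrite tN.
have -> : (2 * c * t ^+ N + W' * (t ^+ N * t)) * (1 + 4 * D * t) =
  2 * c * t ^+ N + (W' + 8 * c * D) * (t ^+ N * t) + 4 * (W' * D * (t ^+ N * t) * t).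
  by ring.
have -> : (W' + 8 * c * D + 4 * D * W') * (t ^+ N * t) =
  (W' + 8 * c * D) * (t ^+ N * t) + 4 * (W' * D * (t ^+ N * t)) by ring.
by rewrite addrA lerD2l ler_wpM2l.
Qed.

End ShortTime.

(** * Uniqueness of a short-time expansion *)

Section ExpansionUniqueness.
Variable R : realType.
Implicit Types (a c M t eta d : R).

Lemma exists_small_powR (eps d eta : R) : 0 < eps -> 0 < d -> 0 < eta ->
  exists t, [/\ 0 < t <= 1, t < eps, t <= eta & t `^ d <= eta].
Proof.
move=> eps0 d0 eta0; pose t := Num.min 1 (Num.min (eps / 2) (Num.min eta (eta `^ d^-1))).
have t0 : 0 < t by rewrite !lt_min ltr01 eta0 powR_gt0 // divr_gt0.
exists t; split.
- by rewrite t0 ge_min lexx.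
- rewrite (@le_lt_trans _ _ (eps / 2)) //; first by rewrite !ge_min lexx orbT.
  by rewrite ltr_pdivrMr // mulr_natr mulr2n ltrDl.
- by rewrite !ge_min lexx !orbT.
have -> : eta = (eta `^ d^-1) `^ d by rewrite -powRrM mulVf ?gt_eqF // powRr1 // ltW.
apply: ge0_ler_powR; rewrite ?nnegrE ?powR_ge0 ?(ltW d0) ?(ltW t0) //.
by rewrite !ge_min lexx !orbT.
Qed.

Lemma powRD_gt0 t a d : 0 < t -> t `^ (a + d) = t `^ a * t `^ d.
Proof. by move=> t0; rewrite powRD // (gt_eqF t0) implybT. Qed.

(** Otherwise the two bounds together give, after division by [t `^ a],
    [c <= c' * t `^ (a' - a) + O(t)], whose right-hand side tends to 0. *)
Lemma expansion_exponent_le (f : R -> R) a c M a' c' M' eps : 0 < eps -> 0 < c ->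
  0 <= c' -> 0 <= M -> 0 <= M' ->
  (forall t, 0 < t < eps -> f t <= 1 - c * t `^ a + M * t `^ (a + 1)) ->
  (forall t, 0 < t < eps -> 1 - c' * t `^ a' - M' * t `^ (a' + 1) <= f t) ->
  a' <= a.
Proof.
move=> eps0 c0 c'0 M0 M'0 up low; have [//|aa'] := leP a' a.
suff : c <= 0 by rewrite leNgt c0.
have d0 : 0 < a' - a by rewrite subr_gt0.
apply: (@le0_small _ _ (c' + M + M')); first by rewrite !addr_ge0.
move=> eta eta0; have [t [/andP[t0 t1] teps te tde]] := exists_small_powR eps0 d0 eta0.
have tb : 0 < t < eps by rewrite t0.
have := le_trans (low t tb) (up t tb).
have aE : a' = a + (a' - a) by rewrite addrC subrK.
rewrite {1 2}aE; move: (a' - a) tde => d tde.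
rewrite !powRD_gt0 // (powRr1 (ltW t0)).
have ta0 : 0 < t `^ a by rewrite powR_gt0.
rewrite -(subr_ge0 _ (1 - _ + _)).
have -> : 1 - c * t `^ a + M * (t `^ a * t) -
  (1 - c' * (t `^ a * t `^ d) - M' * (t `^ a * t `^ d * t)) =
  t `^ a * (c' * t `^ d + M * t + M' * (t `^ d * t) - c) by ring.
rewrite pmulr_rge0 // subr_ge0 => /le_trans; apply.
rewrite !mulrDl !lerD ?ler_wpM2l //.
by apply: le_trans tde; rewrite ler_piMr // powR_ge0.
Qed.

Lemma expansion_coefficient_le (f : R -> R) a c M c' M' eps : 0 < eps ->
  0 <= M -> 0 <= M' ->
  (forall t, 0 < t < eps -> f t <= 1 - c * t `^ a + M * t `^ (a + 1)) ->
  (forall t, 0 < t < eps -> 1 - c' * t `^ a - M' * t `^ (a + 1) <= f t) ->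
  c <= c'.
Proof.
move=> eps0 M0 M'0 up low; rewrite -subr_le0.
apply: (@le0_small _ _ (M + M')); first by rewrite !addr_ge0.
move=> eta eta0; have [t [/andP[t0 t1] teps te _]] := exists_small_powR eps0 ltr01 eta0.
have tb : 0 < t < eps by rewrite t0.
have := le_trans (low t tb) (up t tb).
rewrite !powRD_gt0 // (powRr1 (ltW t0)).
have ta0 : 0 < t `^ a by rewrite powR_gt0.
rewrite -(subr_ge0 _ (1 - _ + _)).
have -> : 1 - c * t `^ a + M * (t `^ a * t) - (1 - c' * t `^ a - M' * (t `^ a * t)) =
  t `^ a * ((M + M') * t - (c - c')) by ring.
rewrite pmulr_rge0 // subr_ge0 => /le_trans; apply.
by rewrite ler_wpM2l // addr_ge0.
Qed.

Lemma expansion_unique n (B : 'M[R[i]]_n) a c eps a' c' eps' :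
  0 < c -> 0 < eps -> 0 < c' -> 0 < eps' ->
  short_time_expansion B a c eps -> short_time_expansion B a' c' eps' ->
  a = a' /\ c = c'.
Proof.
move=> c0 eps0 c'0 eps'0 [M M0 HM] [M' M'0 HM'].
pose f t := opnorm2 (expmx (- (t%:C%C *: B))).
pose e := Num.min eps eps'; have e0 : 0 < e by rewrite lt_min eps0.
have up t : 0 < t < e -> f t <= 1 - c * t `^ a + M * t `^ (a + 1).
  move=> /andP[t0]; rewrite lt_min => /andP[te _].
  have := HM t; rewrite (ltW t0) te => /(_ isT) /ler_normlP[_].
  by rewrite lerBlDl.
have low t : 0 < t < e -> 1 - c * t `^ a - M * t `^ (a + 1) <= f t.
  move=> /andP[t0]; rewrite lt_min => /andP[te _].
  have := HM t; rewrite (ltW t0) te => /(_ isT) /ler_normlP[+ _].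
  by rewrite opprB lerBlDl -lerBlDr.
have up' t : 0 < t < e -> f t <= 1 - c' * t `^ a' + M' * t `^ (a' + 1).
  move=> /andP[t0]; rewrite lt_min => /andP[_ te].
  have := HM' t; rewrite (ltW t0) te => /(_ isT) /ler_normlP[_].
  by rewrite lerBlDl.
have low' t : 0 < t < e -> 1 - c' * t `^ a' - M' * t `^ (a' + 1) <= f t.
  move=> /andP[t0]; rewrite lt_min => /andP[_ te].
  have := HM' t; rewrite (ltW t0) te => /(_ isT) /ler_normlP[+ _].
  by rewrite opprB lerBlDl -lerBlDr.
have aa' : a = a'.
  apply/eqP; rewrite eq_le; apply/andP; split.
    exact: (expansion_exponent_le e0 c'0 (ltW c0) (ltW M'0) (ltW M0) up' low).
  exact: (expansion_exponent_le e0 c0 (ltW c'0) (ltW M0) (ltW M'0) up low').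
split=> //; subst a'; apply/eqP; rewrite eq_le; apply/andP; split.
  exact: (expansion_coefficient_le e0 (ltW M0) (ltW M'0) up low').
exact: (expansion_coefficient_le e0 (ltW M'0) (ltW M0) up' low).
Qed.

End ExpansionUniqueness.

(** * The short-time expansion *)

Section MainExpansion.
Variables (R : realType) (n' : nat).
Local Notation n := n'.+1.
Variable B : 'M[R[i]]_n.
Hypothesis B_cd : psdmx (hermpart B).
Implicit Types (x y : 'cV[R[i]]_n) (t : R) (k m N : nat).
Local Notation p := (seminorm (hermpart B)).
Local Notation flow t := (expmx (- (t%:C%C *: B))).

Theorem short_time_main m s x0 : 0 <= s -> silent B m x0 -> vnorm x0 = 1 ->
  p (B ^+ m *m x0) = s ->
  (forall x, silent B m x -> s * vnorm x <= p (B ^+ m *m x)) ->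
  exists2 eps, 0 < eps &
    short_time_expansion B (2 * m + 1)%:R (decay_rate m s) eps.
Proof.
move=> s0 x0_silent x01 x0s x0_min; set N := (2 * m + 1)%N.
have [U U0 HU] := flow_upper_bound B_cd s0 x0_min.
have [L [eps [L0 /andP[eps0 eps1] HL]]] := flow_lower_bound B_cd s0 x0_silent x01 x0s.
have c0 : 0 <= decay_rate m s.
  rewrite /decay_rate !mulr_ge0 ?sqr_ge0 // ltW // exprn_gt0 //.
move: (decay_rate m s) c0 HU HL => c c0 HU HL.
pose K := 2 * c + L; have K0 : 0 <= K by rewrite addr_ge0 // mulr_ge0.
have K1 : 0 < K + 1 by rewrite ltr_wpDl.
exists (Num.min eps (K + 1)^-1); first by rewrite lt_min eps0 invr_gt0.
exists (U + L + K ^+ 2 + 1).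
  by rewrite ltr_wpDl // !addr_ge0 ?sqr_ge0.
move=> t /andP[t0]; rewrite lt_min => /andP[teps tK].
have t1 : t <= 1 by rewrite (le_trans (ltW teps)).
have t01 : 0 <= t <= 1 by rewrite t0.
have NE : (2 * m + 2)%N = N.+1 by rewrite /N addn1 addn2.
have -> : N%:R + 1 = N.+1%:R :> R by rewrite -natr1.
rewrite !powR_mulrn //.
have tN0 : 0 <= t ^+ N.+1 by rewrite exprn_ge0.
have tN1 : t ^+ N.+1 <= t by rewrite exprS ler_piMr // exprn_ile1.
have tNt : t ^+ N <= t by rewrite /N addn1 exprS ler_piMr // exprn_ile1.
have [g gE] : exists g, g = opnorm2 (flow t) by eexists.
rewrite -gE; have g0 : 0 <= g by rewrite gE opnorm2_ge0.
have up : g <= 1 - c * t ^+ N + U / 2 * t ^+ N.+1.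
  rewrite gE; apply: opnorm2_le => x x1.
  have := HU t x t01 x1; rewrite -/N NE.
  (* A bound on the square passes to [y] by [2 * y <= 1 + y ^+ 2]. *)
  move: (vnorm _) => y hy; have := sqr_ge0 (y - 1); rewrite sqrrB1; lra.
(* The bound [(K + 1)^-1] on [t] is there to make [w <= 1]. *)
pose w := 2 * c * t ^+ N + L * t ^+ N.+1.
have wK : w <= K * t 
  by rewrite /w /K [leRHS]mulrDl lerD // ler_wpM2l // mulr_ge0.
have w01 : 0 <= w <= 1.
  rewrite /w addr_ge0 ?mulr_ge0 ?exprn_ge0 //= (le_trans wK) //.
  rewrite -(ltr_pM2l K1) mulfV ?gt_eqF // in tK.
  by apply: le_trans (ltW tK); rewrite [leRHS]mulrDl mul1r lerDl.
have low : 1 - w / 2 - w ^+ 2 / 2 <= g.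
  apply: sqrt_ge_quadratic => //; rewrite gE.
  have := HL t; rewrite t0 teps => /(_ isT); rewrite -/N NE /w.
  by rewrite opprD addrA.
have w2 : w ^+ 2 <= K ^+ 2 * t ^+ N.+1.
  have h : w <= K * t ^+ N.
    by rewrite /w /K [leRHS]mulrDl lerD2l ler_wpM2l // exprS ler_piMl // exprn_ge0.
  apply: le_trans (_ : (K * t ^+ N) ^+ 2 <= _).
    by rewrite ler_sqr ?nnegrE ?mulr_ge0 ?exprn_ge0 //; case/andP: w01.
  rewrite [leLHS]exprMn ler_wpM2l ?sqr_ge0 // -exprM ler_wiXn2l //.
  by rewrite muln2 -addnn -addn1 leq_add2l /N addn1.
have LT : 0 <= L * t ^+ N.+1 by rewrite mulr_ge0.
have UT : 0 <= U * t ^+ N.+1 by rewrite mulr_ge0.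
have KT : 0 <= K ^+ 2 * t ^+ N.+1 by rewrite mulr_ge0 ?sqr_ge0.
have -> : (U + L + K ^+ 2 + 1) * t ^+ N.+1 =
  U * t ^+ N.+1 + L * t ^+ N.+1 + K ^+ 2 * t ^+ N.+1 + t ^+ N.+1 by ring.
rewrite ler_norml; apply/andP; split; last first.
  by move: up; rewrite mulrAC; lra.
move: low w2; rewrite {1}/w.
move: (w ^+ 2) (K ^+ 2 * _) KT => w' kt KT low w2; lra.
Qed.

(** Without dissipation the norm is preserved; the energy expansion shows it to
    any order. *)
Lemma flow_undamped y N : (0 < N)%N -> vnorm y = 1 ->
  (forall j, p (B ^+ j *m y) = 0) ->
  exists2 C, 0 <= C & forall t, 0 <= t <= 1 ->
  1 - C * t ^+ N.+1 <= opnorm2 (flow t) ^+ 2.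
Proof.
move=> N0 y1 y_silent; have [C C0 HC] := energy_expansion B_cd N0.
exists C => // t t01; have /ler_normlP[_] := HC t y t01.
have -> : dissipation B t y N = 0.
  rewrite /dissipation big1 ?mulr0 // => k _.
  apply/eqP; rewrite mulf_eq0 expf_eq0 /=; apply/orP; right.
  rewrite eq_le seminorm_ge0 andbT.
  have /andP[t0 t1] := t01.
  apply: le_trans (seminorm_polyact_le B B_cd _ t0 (leqnn _)) _.
  by rewrite big1 // => i _; rewrite y_silent mulr0.
rewrite subr0 y1 expr1n mulr1 lerBlDr addrC -lerBlDr => /le_trans; apply.
rewrite ler_sqr ?nnegrE ?seminorm_ge0 ?opnorm2_ge0 //.
exact: vnorm_mulmx_le_opnorm2.
Qed.

Lemma expansion_damped a c eps y : 0 < a -> 0 < c -> 0 < eps ->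
  short_time_expansion B a c eps -> (forall j, p (B ^+ j *m y) = 0) -> y = 0.
Proof.
move=> a0 c0 eps0 [M M0 HM] y_silent.
apply/eqP; apply: contraT => y0; exfalso.
have vy0 : vnorm y != 0 by apply: contraNneq y0 => /vnorm_eq0 ->.
pose z := (vnorm y)^-1%:C%C *: y.
have z1 : vnorm z = 1 by exact: vnorm_normalize.
have z_silent j : p (B ^+ j *m z) = 0.
  by rewrite -scalemxAr (seminormZr B_cd) y_silent mulr0.
pose N := (Num.truncn a).+1.
have aN : a <= N%:R by rewrite ltW // /N; have /andP[] := Num.Theory.truncn_itv (ltW a0).
have [C C0 HC] := flow_undamped (ltn0Sn _ : (0 < N)%N) z1 z_silent.
suff : c <= 0 by rewrite leNgt c0.
apply: (@le0_small _ _ (M + C)); first by rewrite addr_ge0 // ltW.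
move=> eta eta0; have [t [/andP[t0 t1] teps te _]] := exists_small_powR eps0 ltr01 eta0.
have t01 : 0 <= t <= 1 by rewrite (ltW t0).
have := HM t; rewrite (ltW t0) teps => /(_ isT) /ler_normlP[_].
have := HC t t01; have := opnorm2_ge0 (flow t).
move: (opnorm2 _) => g g0 glow gup.
have ta0 : 0 < t `^ a by rewrite powR_gt0.
have tN : C * t ^+ N.+1 <= C * (t `^ a * t).
  rewrite ler_wpM2l // -(powR_mulrn _ (ltW t0)) -[X in _ * X](powRr1 (ltW t0)).
  rewrite -powRD_gt0 //; apply: ger_powR; first by rewrite t0.
  by rewrite -[N.+1%:R]natr1 lerD2r.
rewrite powRD_gt0 // (powRr1 (ltW t0)) in gup.
have : t `^ a * c <= t `^ a * ((M + C) * t).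
  have Mt : 0 <= M * (t `^ a * t) by rewrite !mulr_ge0 ?(ltW M0) ?(ltW t0) ?(ltW ta0).
  have Ct : 0 <= C * (t `^ a * t) by rewrite !mulr_ge0 ?(ltW t0) ?(ltW ta0).
  have -> : t `^ a * ((M + C) * t) = M * (t `^ a * t) + C * (t `^ a * t) by ring.
  rewrite mulrC; have [g1|g1] := lerP 1 g; first by lra.
  by have gg : g ^+ 2 <= g; [rewrite expr2 ler_piMr // ltW|lra].
rewrite ler_pM2l // => /le_trans; apply.
by rewrite ler_wpM2l // addr_ge0 // ltW.
Qed.

End MainExpansion.

(** * Existence of a minimizer *)

Section MinimizerExists.
Variables (R : realType) (n' : nat).
Local Notation n := n'.+1.
Variable B : 'M[R[i]]_n.
Hypothesis B_cd : psdmx (hermpart B).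
Implicit Types (x y : 'cV[R[i]]_n) (z w : 'rV[R]_(n + n)).
Local Notation p := (seminorm (hermpart B)).

(** Identifies complex vectors with real row vectors, so as to use the
    Heine-Borel theorem. *)
Definition complexify z : 'cV[R[i]]_n :=
  \col_i (z 0 (lshift n i) +i* z 0 (rshift n i))%C.

Lemma complexifyB z w : complexify (z - w) = complexify z - complexify w.
Proof. by apply/colP => i; rewrite !mxE. Qed.

Lemma complexify_surj x : exists z, complexify z = x.
Proof.
exists (row_mx (\row_i complex.Re (x i 0)) (\row_i complex.Im (x i 0))).
apply/colP => i; rewrite mxE row_mxEl row_mxEr !mxE.
by case: (x i 0).
Qed.

Lemma coord_le_norm z j : `|z 0 j| <= `|z|.
Proof.
have /mapP[k Hk ->] : `|z 0 j| \in [seq `|z k.1 k.2| | k : 'I_1 * 'I_(n + n)].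
  by apply/mapP; exists (0, j) => //=; rewrite mem_enum.
by rewrite [leRHS]/Num.norm /= mx_normrE; apply/bigmax_geP; right => /=; exists k.
Qed.

Lemma seminorm_complexify_le H : psdmx H -> exists2 C, 0 <= C &
  forall z, seminorm H (complexify z) <= C * `|z|.
Proof.
move=> H_psd; exists ((\sum_j seminorm H (delta_mx j 0)) * 2).
  by rewrite mulr_ge0 // sumr_ge0 // => j _; exact: seminorm_ge0.
move=> z; rewrite (colE_sum (complexify z)) -mulrA.
apply: seminorm_basis_le => // j; rewrite mxE.
apply: le_trans (modulus_leReIm _) _ => /=.
by rewrite mulr_natl mulr2n lerD // coord_le_norm.
Qed.

Lemma norm_le_complexify z : `|z| <= vnorm (complexify z).
Proof.
rewrite [leLHS]/Num.norm /= mx_normrE; apply/bigmax_leP; split.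
  exact: seminorm_ge0.
move=> [i j] _ /=; rewrite ord1; case: (split_ordP j) => k ->.
  apply: le_trans (coord_le_vnorm _ k); rewrite mxE.
  exact: le_trans (Re_le_modulus (_ +i* _)%C).
apply: le_trans (coord_le_vnorm _ k); rewrite mxE.
exact: le_trans (Im_le_modulus (_ +i* _)%C).
Qed.

Lemma seminorm_mulmx_continuous H (A : 'M[R[i]]_n) : psdmx H ->
  continuous (fun z => seminorm H (A *m complexify z)).
Proof.
move=> H_psd; have [C C0 HC] := seminorm_mulmx_bounded H_psd A.
have [D D0 HD] := seminorm_complexify_le (psdmx1 R n).
have lip z w : `|seminorm H (A *m complexify z) - seminorm H (A *m complexify w)| <=
    C * D * `|z - w|.
  apply: le_trans (_ : seminorm H (A *m complexify (z - w)) <= _); last first.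
    by apply: le_trans (HC _) _; rewrite -mulrA ler_wpM2l.
  rewrite complexifyB mulmxBr ler_norml; apply/andP; split; last exact: ler_seminormB.
  rewrite lerNl opprB -(seminormN H_psd (_ - _)) opprB; exact: ler_seminormB.
move=> z; apply/(@cvgrPdist_lt _ _ _ (nbhs z) _) => e e0.
have K0 : 0 < C * D + 1 by rewrite ltr_wpDl // mulr_ge0.
near=> w; apply: le_lt_trans (lip z w) _.
apply: le_lt_trans (_ : (C * D + 1) * `|z - w| < _).
  by rewrite ler_wpM2r // lerDl.
rewrite -ltr_pdivlMl //; near: w.
apply: (@cvgr_dist_lt _ _ _ (nbhs z) _ id) => //.
by rewrite mulr_gt0 ?invr_gt0.
Unshelve. all: by end_near.
Qed.

Definition silent_sphere m : set 'rV[R]_(n + n) :=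
  [set z | silent B m (complexify z) /\ vnorm (complexify z) = 1].

Lemma silent_sphere_compact m : compact (silent_sphere m).
Proof.
have closed_eq_preimage (f : 'rV[R]_(n + n) -> R) (a : R) : continuous f ->
    closed [set z | f z = a].
  by move=> fc; exact: (preimage_closed (D := [set a])).
apply: bounded_closed_compact.
  exists 1; split; first exact: num_real.
  move=> M M1 z [_ z1]; apply: le_trans (norm_le_complexify z) _.
  by rewrite z1 ltW.
have -> : silent_sphere m =
    (\bigcap_(j in [set j | (j < m)%N]) [set z | p (B ^+ j *m complexify z) = 0])
    `&` [set z | vnorm (1%:M *m complexify z) = 1].
  apply/seteqP; split=> z /= [z_silent]; rewrite ?mul1mx => z1; split=> //.
apply: closedI.
  apply: closed_bigI => j _; apply: closed_eq_preimage.
  exact: seminorm_mulmx_continuous.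
apply: closed_eq_preimage; apply: seminorm_mulmx_continuous; exact: psdmx1.
Qed.

Lemma silentZ m x (a : R[i]) : silent B m x -> silent B m (a *: x).
Proof. by move=> h j jm; rewrite -scalemxAr (seminormZ B_cd) h // mulr0. Qed.

(** Seminorms are Lipschitz, so the silent unit vectors form a compact set on
    which [p (B ^+ m *m _)] attains its minimum; homogeneity extends the bound to
    all silent vectors. *)
Theorem minimizer_exists m x : silent B m x -> x != 0 -> exists x0,
  [/\ silent B m x0, vnorm x0 = 1 &
  forall y, silent B m y -> p (B ^+ m *m x0) * vnorm y <= p (B ^+ m *m y)].
Proof.
have unit_silent y : silent B m y -> y != 0 ->
    silent B m ((vnorm y)^-1%:C%C *: y) /\ vnorm ((vnorm y)^-1%:C%C *: y) = 1.
  move=> ys y0; split; first exact: silentZ.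
  by apply: vnorm_normalize; apply: contraNneq y0 => /vnorm_eq0 ->.
move=> xs x0; have [us u1] := unit_silent x xs x0.
have [u uE] := complexify_surj ((vnorm x)^-1%:C%C *: x).
have [|z zS zmin] := compact_EVT_min (f := fun z => p (B ^+ m *m complexify z))
    _ (@silent_sphere_compact m)
    (continuous_subspaceT (@seminorm_mulmx_continuous _ (B ^+ m) B_cd)).
  by exists u; rewrite /silent_sphere /= uE.
have [zs z1] : silent_sphere m z by rewrite inE in zS.
exists (complexify z); split=> // y ys.
have [->|y0] := eqVneq y 0; first by rewrite seminorm0 mulr0 seminorm_ge0.
have [vs v1] := unit_silent y ys y0.
have [v vE] := complexify_surj ((vnorm y)^-1%:C%C *: y).
have : v \in silent_sphere m by rewrite inE /silent_sphere /= vE.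
move/zmin; rewrite vE -scalemxAr (seminormZr B_cd).
have y_gt0 : 0 < vnorm y.
  by rewrite lt0r seminorm_ge0 andbT; apply: contraNneq y0 => /vnorm_eq0 ->.
by rewrite ger0_norm ?invr_ge0 ?(ltW y_gt0) // ler_pdivlMl // mulrC.
Qed.

End MinimizerExists.

(** * Hypocoercivity, the index, and the theorem *)

Section Hypocoercivity.
Variables (R : realType) (n' : nat).
Local Notation n := n'.+1.
Variable B : 'M[R[i]]_n.
Hypothesis B_cd : psdmx (hermpart B).
Implicit Types (x y w : 'cV[R[i]]_n) (z : R[i]) (m j : nat).
Local Notation H := (hermpart B).
Local Notation BA := (antihermpart B).
Local Notation p := (seminorm H).

(** By [hypocoerciveP] these are the vectors that obstruct hypocoercivity. *)
Definition undamped y := forall j, p (B ^+ j *m y) = 0.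

Lemma hermpartD : H + BA = B.
Proof.
rewrite /hermpart /antihermpart -scalerDr addrACA subrr addr0 -mulr2n.
by rewrite -[B *+ 2]scaler_nat scalerA mulVf ?scale1r // pnatr_eq0.
Qed.

Lemma antihermpart_adj : BA^t* = - BA.
Proof.
apply/matrixP => i j; rewrite !mxE rmorphM /= rmorphB /= conjCK.
have -> : (2^-1 : R[i])^* = 2^-1 by rewrite fmorphV rmorph_nat.
by rewrite -mulrN opprB.
Qed.

Lemma mulmx_antihermpart y : p y = 0 -> B *m y = BA *m y.
Proof.
by move/(seminorm_eq0 B_cd) => Hy; rewrite -{1}hermpartD mulmxDl Hy add0r.
Qed.

Lemma mulmx_exprS (E : 'M[R[i]]_n) j x : E ^+ j.+1 *m x = E *m (E ^+ j *m x).
Proof. by rewrite mulmxA mulmxE -exprS. Qed.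

(** With [E] and [F] taken to be [B] and [antihermpart B] in either order, this
    is why the two families of forms have the same kernels and agree there at
    the next order: the two matrices differ by [hermpart B], which kills the
    intermediate vectors. *)
Lemma eq_powers_mulmx (E F : 'M[R[i]]_n) m x :
  (forall y, p y = 0 -> E *m y = F *m y) ->
  (forall j, (j < m)%N -> p (E ^+ j *m x) = 0) ->
  forall j, (j <= m)%N -> F ^+ j *m x = E ^+ j *m x.
Proof.
move=> EF Ex; elim=> [|j IH] jm; first by rewrite !expr0.
by rewrite !mulmx_exprS (IH (ltnW jm)) (EF _ (Ex _ jm)).
Qed.

Lemma silent_antihermpart m x : silent B m x ->
  BA ^+ m *m x = B ^+ m *m x.
Proof.
by move=> xs; exact: (eq_powers_mulmx mulmx_antihermpart xs (leqnn m)).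
Qed.

Lemma silent_antihermpartE m x :
  (forall j, (j < m)%N -> p (BA^t* ^+ j *m x) = 0) <-> silent B m x.
Proof.
have adjE j : p (BA^t* ^+ j *m x) = p (BA ^+ j *m x).
  rewrite antihermpart_adj exprNn -signr_odd; case: (odd j); last by rewrite mul1r.
  by rewrite expr1 mulN1r mulNmx seminormN.
have powE := eq_powers_mulmx mulmx_antihermpart.
have powE' := eq_powers_mulmx (fun y py => esym (mulmx_antihermpart py)).
split=> xs j jm.
  have xs' i : (i < m)%N -> p (BA ^+ i *m x) = 0 by rewrite -adjE; exact: xs.
  by rewrite (powE' _ _ xs' _ (ltnW jm)) xs'.
by rewrite adjE (powE _ _ xs _ (ltnW jm)) xs.
Qed.

Lemma hc_T_posdef m : posdefmx (hc_T B m) <-> forall x, silent B m.+1 x -> x = 0.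
Proof.
have -> : hc_T B m = gram_sum H (fun j => BA^t* ^+ j) m.+1.
  by apply: eq_bigr => j _; rewrite trmxC_exp trmxCK.
apply: (iff_trans (gram_sum_posdef (fun j => BA^t* ^+ j) B_cd m.+1)).
split=> h x xs; apply: h; first exact: ((silent_antihermpartE m.+1 x).2 xs).
exact: ((silent_antihermpartE m.+1 x).1 xs).
Qed.

Lemma hc_Ttilde2_ker m x : hc_Ttilde2 B m *m x = 0 <-> silent B m.+1 x.
Proof.
have -> : hc_Ttilde2 B m = gram_sum H (fun j => B ^+ j) m.+1.
  by apply: eq_bigr => j _; rewrite trmxC_exp.
exact: (gram_sum_ker (fun j => B ^+ j) B_cd).
Qed.

(** By the Cayley-Hamilton theorem every power of [B] is a combination of those of
    exponent less than [n]. *)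
Lemma silent_undamped x : silent B n x -> undamped x.
Proof.
move=> xs j.
have chi0 : char_poly B != 0 by rewrite monic_neq0 // char_poly_monic.
pose r := 'X^j %% char_poly B.
have Bj : B ^+ j = horner_mx B r.
  rewrite -[X in X ^+ j](horner_mx_X B) -(rmorphXn (horner_mx B)).
  rewrite {1}(divp_eq 'X^j (char_poly B)) rmorphD rmorphM /= Cayley_Hamilton.
  by rewrite mulr0 add0r.
have rn : (size r <= n)%N by rewrite -ltnS -(size_char_poly B) ltn_modp.
rewrite Bj /horner_mx /horner_morph (@horner_coef_wide _ n); last first.
  by rewrite (leq_trans (size_poly _ _)).
rewrite mulmx_suml; apply/eqP; rewrite eq_le seminorm_ge0 andbT.
apply: le_trans (seminorm_sum B_cd _ _ _) _; rewrite big1 // => i _.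
rewrite coef_map /= -mulmxE mul_scalar_mx.
have -> : (r`_i *: B ^+ i) *m x = r`_i *: (B ^+ i *m x) by rewrite scalemxAl.
by rewrite (seminormZ B_cd) xs ?mulr0.
Qed.

(** Undamped vectors are stable under [B].  Applying the factors of the
    characteristic polynomial to [x] one by one, the last nonzero vector is an
    eigenvector. *)
Lemma undamped_eigenvector x : x != 0 -> undamped x ->
  exists z w, [/\ w != 0, B *m w = z *: w & p w = 0].
Proof.
move=> x0 xu.
have [s sE] := closed_field_poly_normal (char_poly B).
have : horner_mx B (\prod_(z <- s) ('X - z%:P)) *m x = 0.
  have := Cayley_Hamilton B; rewrite sE.
  by rewrite (monicP (char_poly_monic B)) scale1r => ->; rewrite mul0mx.
elim: s x x0 xu {sE} => [|z s IH] x x0 xu.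
  by rewrite big_nil rmorph1 mul1mx => /eqP; rewrite (negPf x0).
rewrite big_cons mulrC rmorphM -[_ * _]/(_ *m _) -mulmxA /=.
rewrite rmorphB /= horner_mx_X horner_mx_C mulmxBl mul_scalar_mx.
have [e _|y0] := eqVneq (B *m x - z *: x) 0.
  exists z, x; split=> //; first by apply/eqP; rewrite -subr_eq0 e.
  by have := xu 0%N; rewrite expr0 mul1mx.
apply: IH => // j.
have -> : B ^+ j *m (B *m x - z *: x) = B ^+ j.+1 *m x + - z *: (B ^+ j *m x).
  by rewrite mulmxBr -scalemxAr scaleNr mulmxA mulmxE -exprSr.
apply/eqP; rewrite eq_le seminorm_ge0 andbT.
apply: le_trans (seminormD B_cd _ _) _.
by rewrite (seminormZ B_cd) !xu mulr0 addr0.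
Qed.

Lemma hform_eigenvector z w : B *m w = z *: w ->
  hform H w w = complex.Re z * vnorm w ^+ 2.
Proof.
move=> Bw; have I1h := proj1 (psdmx1 R n).
have zE : hform 1%:M (z *: w) w = complex.Re z * vnorm w ^+ 2.
  rewrite hform.unlock innerpZl innerp_hform // mulrC Re_realM mulrC.
  by rewrite (sqr_seminorm (psdmx1 R n)).
apply: (mulfI (_ : 2 != 0 :> R)); first by rewrite pnatr_eq0.
by rewrite hform_hermpart Bw (hform_sym I1h w) zE; ring.
Qed.

Lemma eigenvalue_col z :
  eigenvalue B z <-> exists2 w : 'cV[R[i]]_n, w != 0 & B *m w = z *: w.
Proof.
have -> : eigenvalue B z = eigenvalue B^T z.
  rewrite !eigenvalue_root_char; congr (root _ z).
  by rewrite /char_poly -det_tr /char_poly_mx linearB /= tr_scalar_mx map_trmx.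
split=> [/eigenvalueP[v vB v0]|[w w0 Bw]].
  exists v^T; first by rewrite trmx_eq0.
  by apply: trmx_inj; rewrite trmx_mul trmxK vB linearZ /= trmxK.
apply/eigenvalueP; exists w^T; last by rewrite trmx_eq0.
by rewrite -trmx_mul Bw linearZ.
Qed.

(** For an eigenvector [w] the form of [hermpart B] is [Re z * |w|^2], so it
    vanishes exactly when the eigenvalue is imaginary, and it cannot be negative. *)
Lemma hypocoerciveP : hypocoercive B <-> forall y, undamped y -> y = 0.
Proof.
split=> [hyp y yu|yu z /eigenvalue_col[w w0 Bw]].
  apply/eqP; apply: contraT => y0; exfalso.
  have [z [w [w0 Bw pw]]] := undamped_eigenvector y0 yu.
  have : 0 < complex.Re z by apply: hyp; apply/eigenvalue_col; exists w.
  have := hform_eigenvector Bw; rewrite -(sqr_seminorm B_cd) pw expr0n /=.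
  move/esym/eqP; rewrite mulf_eq0 sqrf_eq0 => /orP[/eqP->|/eqP/vnorm_eq0 e].
    by rewrite ltxx.
  by rewrite e eqxx in w0.
rewrite ltNge; apply/negP => z0.
have pw : p w = 0.
  apply/eqP; rewrite -sqrf_eq0 (sqr_seminorm B_cd) eq_le hform_ge0 // andbT.
  by rewrite (hform_eigenvector Bw) mulr_le0_ge0 ?sqr_ge0.
have : undamped w.
  move=> j; have -> : B ^+ j *m w = z ^+ j *: w.
    elim: j => [|j IH]; first by rewrite !expr0 mul1mx scale1r.
    by rewrite mulmx_exprS IH -scalemxAr Bw scalerA exprSr.
  by rewrite (seminormZ B_cd) pw mulr0.
by move/yu => e; rewrite e eqxx in w0.
Qed.

Lemma hc_index_exists : (forall y, undamped y -> y = 0) -> exists m, hc_index B m.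
Proof.
move=> yu; have ex : exists m, `[< posdefmx (hc_T B m) >].
  exists n'; apply/asboolP/hc_T_posdef => x xs; apply: yu; exact: silent_undamped.
exists (ex_minn ex); case: ex_minnP => m /asboolP mP mmin; split=> // k kP.
by apply: mmin; apply/asboolP.
Qed.

(** Minimality of the index provides a silent vector, and definiteness at the index
    makes the minimum positive. *)
Lemma hc_index_minimizer m : hc_index B m -> exists x0,
  [/\ silent B m x0, vnorm x0 = 1, 0 < p (B ^+ m *m x0) &
  forall y, silent B m y -> p (B ^+ m *m x0) * vnorm y <= p (B ^+ m *m y)].
Proof.
move=> [mP mmin].
have [x xs x0] : exists2 x, silent B m x & x != 0.
  case: m mP mmin => [|m] mP mmin.
    exists (delta_mx 0 0) => //; apply/eqP => e.
    have := vnorm_delta R (0 : 'I_n); rewrite e seminorm0 => /esym/eqP.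
    by rewrite oner_eq0.
  apply: contrapT => no; have : posdefmx (hc_T B m).
    apply/hc_T_posdef => x xs; apply/eqP; apply: contraT => x0.
    by case: no; exists x.
  by move/mmin; rewrite ltnn.
have [u [us u1 umin]] := minimizer_exists B_cd xs x0; exists u; split=> //.
rewrite lt0r seminorm_ge0 andbT; apply/eqP => pu.
have us' : silent B m.+1 u by move=> j; rewrite ltnS leq_eqVlt => /orP[/eqP->|/us].
move: u1; rewrite ((hc_T_posdef m).1 mP u us') seminorm0 => /esym/eqP.
by rewrite oner_eq0.
Qed.

Lemma decay_rate_gt0 m (s : R) : 0 < s -> 0 < decay_rate m s.
Proof.
by move=> s0; rewrite /decay_rate !mulr_gt0 ?exprn_gt0 ?lead_moment_gt0 // ltr0n addn1.
Qed.

Lemma decay_rateE m (s : R) :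
  decay_rate m s = (((2 * m + 1)`!)%:R * ('C(2 * m, m))%:R)^-1 * s ^+ 2.
Proof.
rewrite /decay_rate /lead_moment; congr (_ * _).
have := @bin_fact (2 * m) m; rewrite mul2n -addnn leq_addl addnK => /(_ isT).
move/(congr1 (fun k => k%:R : R)); rewrite !natrM !addn1 factS natrM.
have := fact_gt0 m; have := fact_gt0 (m + m).
have : (0 < 'C(m + m, m))%N by rewrite bin_gt0 leq_addl.
rewrite -!(ltr0n R); have : 0 < (m + m).+1%:R :> R by rewrite ltr0n.
move: (_`!%:R) ('C(_, _)%:R) (_`!%:R) (_.+1%:R) => f C a b b0 C0 f0 a0 e.
rewrite -e; field; rewrite !gt_eqF //.
Qed.

(** Covers all three minima of the theorem: they differ only in the description
    of the kernel and in the matrix [G], which agrees with [B ^+ m] on silent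
    vectors as far as the form can see. *)
Lemma is_min_silent m x0 (G : 'M[R[i]]_n) (K : set 'cV[R[i]]_n) :
  silent B m x0 -> vnorm x0 = 1 ->
  (forall y, silent B m y -> p (B ^+ m *m x0) * vnorm y <= p (B ^+ m *m y)) ->
  (forall x, K x <-> silent B m x) ->
  (forall x, silent B m x -> p (G *m x) = p (B ^+ m *m x)) ->
  is_min [set innerp x ((G^t* *m H *m G) *m x) | x in K `&` @unit_sphere R n]
    (p (B ^+ m *m x0) ^+ 2).
Proof.
move=> x0s x01 x0min KE GE; split.
  exists x0; last by rewrite (innerp_gram G x0 B_cd) GE.
  by split; [apply/KE|rewrite /unit_sphere /= norm2_seminorm].
move=> _ [x [/KE xs x1] <-]; rewrite (innerp_gram G x B_cd) lecR GE //.
rewrite /unit_sphere /= norm2_seminorm in x1.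
by rewrite ler_sqr ?nnegrE ?seminorm_ge0 // -[leLHS]mulr1 -x1 x0min.
Qed.

End Hypocoercivity.

Theorem theorem2p7 (R : realType) (n : nat) (n_gt0 : (0 < n)%N)
    (B : 'M[R[i]]_n) (B_cd : conservative_dissipative B) :
  [/\ hypocoercive B <->
        (exists a c eps : R,
          [/\ 0 < a, 0 < c, 0 < eps & short_time_expansion B a c eps]),
      (forall a c eps : R, 0 < a -> 0 < c -> 0 < eps ->
        short_time_expansion B a c eps ->
        exists2 m : nat, hc_index B m & a = (2 * m + 1)%N%:R) &
      (forall (m : nat) (a c eps : R), hc_index B m ->
        0 < a -> 0 < c -> 0 < eps -> short_time_expansion B a c eps ->
        ((1 <= m)%N ->
          (exists2 mu : R,
             is_min [set innerp x ((B^t* ^+ m *m hermpart B *m B ^+ m) *m x)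
                    | x in kermx_col (hc_Ttilde2 B m.-1)
                           `&` @unit_sphere R n] mu &
             c = (((2 * m + 1)`!)%:R * ('C(2 * m, m))%:R)^-1 * mu) /\
          (exists2 mu : R,
             is_min [set innerp x (((antihermpart B)^t* ^+ m *m hermpart B
                                      *m antihermpart B ^+ m) *m x)
                    | x in kermx_col (hc_Ttilde2 B m.-1)
                           `&` @unit_sphere R n] mu &
             c = (((2 * m + 1)`!)%:R * ('C(2 * m, m))%:R)^-1 * mu)) /\
        (m = 0%N ->
          is_min [set innerp x (hermpart B *m x) | x in @unit_sphere R n] c))].
Proof.
case: n n_gt0 B B_cd => // n' _ B B_cd; rewrite /conservative_dissipative in B_cd.
have damped a c eps : 0 < a -> 0 < c -> 0 < eps -> short_time_expansion B a c eps ->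
    forall y, undamped B y -> y = 0.
  by move=> a0 c0 eps0 h y; exact: expansion_damped h.
have expansion m x0 : silent B m x0 -> vnorm x0 = 1 ->
    (forall y, silent B m y ->
      seminorm (hermpart B) (B ^+ m *m x0) * vnorm y <=
      seminorm (hermpart B) (B ^+ m *m y)) ->
    exists2 eps, 0 < eps & short_time_expansion B (2 * m + 1)%:R
      (decay_rate m (seminorm (hermpart B) (B ^+ m *m x0))) eps.
  move=> x0s x01 x0min.
  exact: (short_time_main B_cd (seminorm_ge0 _ _) x0s x01 erefl x0min).
split.
- split=> [/(hypocoerciveP B_cd) yu|[a [c [eps [a0 c0 eps0 h]]]]].
    have [m /(hc_index_minimizer B_cd)[x0 [x0s x01 px0 x0min]]] :=
      hc_index_exists B_cd yu.
    have [eps eps0 h] := expansion m x0 x0s x01 x0min.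
    exists (2 * m + 1)%:R, (decay_rate m (seminorm (hermpart B) (B ^+ m *m x0))), eps.
    by split=> //; exact: decay_rate_gt0.
  by apply/(hypocoerciveP B_cd); exact: damped h.
- move=> a c eps a0 c0 eps0 h.
  have [m mP] := hc_index_exists B_cd (damped a c eps a0 c0 eps0 h).
  have [x0 [x0s x01 px0 x0min]] := hc_index_minimizer B_cd mP.
  have [e e0 h'] := expansion m x0 x0s x01 x0min.
  exists m => //.
  by have [] := expansion_unique c0 eps0 (decay_rate_gt0 m px0) e0 h h'.
move=> m a c eps mP a0 c0 eps0 h.
have [x0 [x0s x01 px0 x0min]] := hc_index_minimizer B_cd mP.
have [e e0 h'] := expansion m x0 x0s x01 x0min.
have [_ ->] := expansion_unique c0 eps0 (decay_rate_gt0 m px0) e0 h h'.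
split=> [m1|m0].
  have kerE x : kermx_col (hc_Ttilde2 B m.-1) x <-> silent B m x.
    by rewrite /kermx_col /= hc_Ttilde2_ker // prednK.
  have minE := is_min_silent B_cd x0s x01 x0min kerE.
  split; exists (seminorm (hermpart B) (B ^+ m *m x0) ^+ 2).
  - by rewrite -trmxC_exp; exact: (minE (B ^+ m)).
  - exact: decay_rateE.
  - rewrite -trmxC_exp; apply: (minE (antihermpart B ^+ m)) => x xs.
    by rewrite (silent_antihermpart B_cd xs).
  - exact: decay_rateE.
subst m; rewrite decay_rateE muln0 bin0 mulr1 invr1 mul1r.
have := is_min_silent B_cd (G := 1%:M) (K := setT) x0s x01 x0min.
rewrite setTI trmx1 map_mx1 mul1mx mulmx1; apply=> x //.
Qed.
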